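(* Let $V \subseteq M^k$ be a definable open set. Every correspondence $f: V \rightrightarrows M^l$ is continuous on an open dense subset of $V$, and thus is continuous almost everywhere on $V$.
   Context: Setting. $T$ is a complete NIP theory in a multi-sorted language $L$ with a distinguished home sort, $\mathcal M$ is an $|L|^+$-saturated model of $T$, and $M$ is the home sort of $\mathcal M$. ''Definable'' means definable in $\mathcal M$, possibly with parameters. A definable set $A$ has dp-rank greater than $n$ if for $0 \le i \le n$ there are formulas $\phi_i(x,y_i)$ (parameters allowed) and infinite sets $B_i$ of tuples (from the sorts of $y_i$) such that for every $(b_0,\dots,b_n) \in B_0\times\cdots\times B_n$ there is $a \in A$ such that for all $0 \le i \le n$ and $y \in B_i$: $\mathcal M \models \phi_i(a,y)$ if and only if $y=b_i$. A nonempty set has dp-rank at least $0$. $\mathcal M$ is assumed dp-minimal: $M$ has dp-rank $1$. $M$ is equipped with a definable uniform structure $\mathcal B$: a collection of subsets of $M^2$ of the form $\mathcal B=\{\varphi(M^2,\bar c): \bar c \in D\}$ for some formula $\varphi(x,y,\bar z)$ and some definable set $D$, such that (i) $\bigcap \mathcal B$ is the diagonal of $M^2$; (ii) each $U\in\mathcal B$ is symmetric; (iii) for all $U,V \in \mathcal B$ there is $W \in \mathcal B$ with $W \subseteq U\cap V$; (iv) for all $U \in \mathcal B$ there is $V\in\mathcal B$ with $V \circ V \subseteq U$, where $U\circ V=\{(x,z): \exists y\ (x,y)\in U,\ (y,z)\in V\}$. For $x\in M$ put $U[x]=\{y:(x,y)\in U\}$; $M$ has the topology in which a set is open iff it contains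 some $U[x]$ ($U\in\mathcal B$) around each of its points $x$, and $M^k$ has the product topology. For $x,y\in M^k$ and $U\in\mathcal B$, write $(x,y)\in U$ if $(x_i,y_i)\in U$ for all $i$. It is assumed that $M$ has no isolated points and that every infinite definable subset of $M$ has nonempty interior. Dimension. For a tuple $\bar a \in M^k$ and a small (of cardinality at most $|L|$) parameter set $C$, $\dim(\bar a/C)$ is the minimal $l$ such that some subtuple $\bar a'$ of $\bar a$ of length $l$ satisfies $\bar a \in \mathrm{acl}(C\bar a')$. For a $C$-definable set $A\subseteq M^k$, $\dim(A)=\max\{\dim(\bar a/C):\bar a\in A\}$ (independent of the choice of $C$); $\dim(\emptyset)=-\infty$. A definable $B\subseteq A$ is almost all of $A$ if $\dim(A\setminus B)<\dim(A)$ (and, by convention, $\emptyset$ is almost all of $\emptyset$). A property holds almost everywhere on $A$ if it holds on a definable subset of $A$ that is almost all of $A$. Correspondences. A correspondence $f:E\rightrightarrows F$ consists of definable sets $E,F$ and a definable set $\mathrm{Graph}(f)\subseteq E\times F$ such that for every $x\in E$ the set $f(x)=\{y\in F:(x,y)\in\mathrm{Graph}(f)\}$ is finite and nonempty. For $U\in\mathcal B$ write $(f(x),f(x'))\in U$ if for every $y\in f(x)$ there is $y'\in f(x')$ with $(y,y')\in U$ and for every $y'\in f(x')$ there is $y\in f(x)$ with $(y,y')\in U$. $f$ is continuous at $x\in E$ if for every $W\in\mathcal B$ there is $U\in\mathcal B$ such that $(f(x),f(x'))\in W$ for all $x'\in E$ with $(x,x')\in U$. *)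

(* Defs.v *)
From HB Require Import structures.
From mathcomp Require Import all_boot all_order all_algebra.
From mathcomp Require Import all_classical all_reals all_analysis.

Set Implicit Arguments.
Unset Strict Implicit.
Unset Printing Implicit Defensive.

Local Open Scope classical_set_scope.

(** * Multi-sorted first-order logic *)

Record language := Language {
  lsort : Type;
  home : lsort;
  funsym : Type;
  funsym_arity : funsym -> nat;
  funsym_dom : forall f, 'I_(funsym_arity f) -> lsort;
  funsym_cod : funsym -> lsort;
  relsym : Type;
  relsym_arity : relsym -> nat;
  relsym_dom : forall r, 'I_(relsym_arity r) -> lsort }.

(* [term G s] and [formula G] have their free variables indexed by a type [I],
   the variable [i] being of sort [G i]. A tuple of variables is the case
   [I = 'I_n]; parameters are extra variables (see [pformula]). *)
Inductive term (L : language) (I : Type) (G : I -> lsort L) : lsort L -> Type :=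
| TVar (i : I) : term G (G i)
| TApp (f : funsym L) (t : forall j, term G (funsym_dom (f := f) j)) :
    term G (funsym_cod f).

(* [FEx s p] binds the variable [None] of [p], which has sort [s]. *)
Inductive formula (L : language) (I : Type) (G : I -> lsort L) : Type :=
| FEq (s : lsort L) (t u : term G s)
| FRel (r : relsym L) (t : forall j, term G (relsym_dom (r := r) j))
| FNeg (p : formula G)
| FAnd (p q : formula G)
| FEx (s : lsort L) (p : @formula L (option I) (oapp G s)).

Record structure (L : language) := Structure {
  carrier :> lsort L -> Type;
  carrier_inhabited : forall s, inhabited (carrier s);
  func_interp : forall f : funsym L,
    (forall j, carrier (funsym_dom (f := f) j)) -> carrier (funsym_cod f);
  rel_interp : forall r : relsym L,
    (forall j, carrier (relsym_dom (r := r) j)) -> Prop }.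

(* Tuples of elements of [M] of sorts [G]. *)
Definition asg (L : language) (M : structure L) (I : Type) (G : I -> lsort L) :=
  forall i : I, M (G i).

Definition asg_extend (L : language) (M : structure L) (I : Type)
    (G : I -> lsort L) (s : lsort L) (v : asg M G) (a : M s) :
    asg M (oapp G s) :=
  fun o => match o return M (oapp G s o) with Some i => v i | None => a end.

Fixpoint teval (L : language) (M : structure L) (I : Type) (G : I -> lsort L)
    (v : asg M G) (s : lsort L) (t : term G s) : M s :=
  match t in term _ s return M s with
  | TVar i => v i
  | TApp f t => func_interp (fun j => teval v (t j))
  end.

Fixpoint sat (L : language) (M : structure L) (I : Type) (G : I -> lsort L)
    (p : formula G) : asg M G -> Prop :=
  match p with
  | FEq s t u => fun v => teval v t = teval v u
  | FRel r t => fun v => rel_interp (fun j => teval v (t j))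
  | FNeg p => fun v => ~ sat p v
  | FAnd p q => fun v => sat p v /\ sat q v
  | FEx s p => fun v => exists a : M s, sat p (asg_extend v a)
  end.

Definition sum_sort (L : language) (I J : Type) (G : I -> lsort L)
    (H : J -> lsort L) : I + J -> lsort L :=
  fun x => match x with inl i => G i | inr j => H j end.

Definition vcat (L : language) (M : structure L) (I J : Type)
    (G : I -> lsort L) (H : J -> lsort L) (v : asg M G) (w : asg M H) :
    asg M (sum_sort G H) :=
  fun x => match x return M (sum_sort G H x) with
           | inl i => v i | inr j => w j end.

(** * Theories *)

Definition sentence (L : language) := formula (of_void (lsort L)).

Definition holds (L : language) (M : structure L) (p : sentence L) :=
  sat p (fun i : void => match i return M (of_void (lsort L) i) with end).

Definition theory (L : language) := set (sentence L).

Definition model (L : language) (T : theory L) (M : structure L) :=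
  forall p, T p -> holds M p.

Definition entails (L : language) (T : theory L) (p : sentence L) :=
  forall M : structure L, model T M -> holds M p.

Definition complete_theory (L : language) (T : theory L) :=
  (exists M : structure L, model T M) /\
  forall p : sentence L, entails T p \/ entails T (FNeg p).

(* The formula [p(x; y)] has the independence property: it shatters finite
   sets of every size in a model of [T]. *)
Definition has_IP (L : language) (T : theory L) (m n : nat)
    (G : 'I_m -> lsort L) (H : 'I_n -> lsort L) (p : formula (sum_sort G H)) :=
  exists2 M : structure L, model T M &
  forall d : nat, exists (a : 'I_d -> asg M G) (b : {set 'I_d} -> asg M H),
    forall (i : 'I_d) (S : {set 'I_d}), sat p (vcat (a i) (b S)) <-> i \in S.

Definition NIP (L : language) (T : theory L) :=
  forall (m n : nat) (G : 'I_m -> lsort L) (H : 'I_n -> lsort L)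
    (p : formula (sum_sort G H)), ~ has_IP T p.

(** * Parameters, definability, saturation *)

Definition elt (L : language) (M : structure L) := {s : lsort L & M s}.

Definition param (L : language) (M : structure L) (C : set (elt M)) :=
  {c : elt M | C c}.

Definition param_sort (L : language) (M : structure L) (C : set (elt M))
  (c : param C) : lsort L := projT1 (sval c).

Definition param_val (L : language) (M : structure L) (C : set (elt M)) :
  asg M (@param_sort L M C) := fun c => projT2 (sval c).

(* [L(C)]-formulas. *)
Definition pformula (L : language) (M : structure L) (C : set (elt M))
    (I : Type) (G : I -> lsort L) :=
  formula (sum_sort G (@param_sort L M C)).

Definition psat (L : language) (M : structure L) (C : set (elt M))
    (I : Type) (G : I -> lsort L) (p : pformula C G) (v : asg M G) :=
  sat p (vcat v (@param_val L M C)).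

Definition definable_over (L : language) (M : structure L) (C : set (elt M))
    (I : Type) (G : I -> lsort L) (A : set (asg M G)) :=
  exists p : pformula C G, A = [set v | psat p v].

Definition definable (L : language) (M : structure L) (I : Type)
  (G : I -> lsort L) (A : set (asg M G)) := definable_over setT A.

(* |C| <= |L|, where |L| = aleph_0 + #sorts + #function and relation symbols
   is the number of L-formulas. *)
Definition small (L : language) (M : structure L) (C : set (elt M)) :=
  (C #<= [set: nat + (lsort L + (funsym L + relsym L))])%card.

(* |L|^+-saturation. *)
Definition saturated (L : language) (M : structure L) :=
  forall (C : set (elt M)) (n : nat) (G : 'I_n -> lsort L)
    (P : set (pformula C G)), small C ->
    (forall F, finite_set F -> F `<=` P ->
       exists v : asg M G, forall p, F p -> psat p v) ->
    exists v : asg M G, forall p, P p -> psat p v.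

(** * Powers of the home sort *)

Notation home_set M := (carrier M (home _)).

Definition homes (L : language) (I : Type) : I -> lsort L := fun=> home L.

Notation pow M k := (asg M (@homes _ 'I_k)).

Definition pow1 (L : language) (M : structure L) (a : home_set M) : pow M 1 :=
  fun=> a.

Definition definable1 (L : language) (M : structure L)
  (A : set (home_set M)) := definable [set v : pow M 1 | A (v ord0)].

(** * dp-rank *)

Definition dp_rank_gt (L : language) (M : structure L) (I : Type)
    (G : I -> lsort L) (A : set (asg M G)) (n : nat) :=
  exists (m : 'I_n.+1 -> nat) (H : forall i, 'I_(m i) -> lsort L)
    (p : forall i, pformula [set: elt M] (sum_sort G (@H i)))
    (B : forall i, set (asg M (@H i))),
    (forall i, infinite_set (B i)) /\
    forall b : (forall i, asg M (@H i)), (forall i, B i (b i)) ->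
      exists2 a : asg M G, A a &
        forall i y, B i y -> (psat (p i) (vcat a y) <-> y = b i).

Definition dp_rank_ge (L : language) (M : structure L) (I : Type)
    (G : I -> lsort L) (A : set (asg M G)) (n : nat) :=
  match n with 0 => A !=set0 | n'.+1 => dp_rank_gt A n' end.

Definition dp_rank_eq (L : language) (M : structure L) (I : Type)
    (G : I -> lsort L) (A : set (asg M G)) (n : nat) :=
  dp_rank_ge A n /\ ~ dp_rank_gt A n.

Definition dp_minimal (L : language) (M : structure L) :=
  dp_rank_eq [set: pow M 1] 1.

(** * Uniform structures *)

(* Nonemptiness of [B] is implicit in the notion: without it the whole space
   would not be open. It follows from [unif_diag] as soon as [X] has two
   points. *)
Record uniform_structure (X : Type) (B : set (set (X * X))) : Prop := {
  unif_nonempty : B !=set0;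
  unif_diag : \bigcap_(U in B) U = diagonal;
  unif_sym : forall U, B U -> (U^-1)%relation = U;
  unif_meet : forall U V, B U -> B V -> exists2 W, B W & W `<=` U `&` V;
  unif_split : forall U, B U -> exists2 V, B V & (V \; V)%relation `<=` U }.

(* [B] is a definable family [{p(M^2, c) : c in D}]. *)
Definition definable_family2 (L : language) (M : structure L)
    (B : set (set (home_set M * home_set M))) :=
  exists (n : nat) (H : 'I_n -> lsort L) (D : set (asg M H))
    (p : pformula [set: elt M]
           (sum_sort (sum_sort (@homes L 'I_1) (@homes L 'I_1)) H)),
    definable D /\
    B = [set [set xy | psat p (vcat (vcat (pow1 xy.1) (pow1 xy.2)) c)]
          | c in D].

Section uniform_topology.
Context {X : Type} {B : set (set (X * X))}.

Definition utop (hB : uniform_structure B) : Type := X.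

Variable hB : uniform_structure B.

HB.instance Definition _ := gen_eqMixin (utop hB).
HB.instance Definition _ := gen_choiceMixin (utop hB).

Definition uopen : set (set (utop hB)) :=
  [set A | forall x, A x -> exists2 U, B U & xsection U x `<=` A].

Let uopenT : uopen setT.
Proof. by move=> x _; have [U BU] := unif_nonempty hB; exists U. Qed.

Let uopenI : setI_closed uopen.
Proof.
move=> A A' oA oA' x [/oA[U BU sU] /oA'[V BV sV]].
have [W BW sW] := unif_meet hB BU BV; exists W => // y.
rewrite /xsection/= inE => /sW[Uxy Vxy].
by split; [apply: sU | apply: sV]; rewrite /xsection/= inE.
Qed.

Let uopen_bigU (I : Type) (f : I -> set (utop hB)) :
  (forall i, uopen (f i)) -> uopen (\bigcup_i f i).
Proof.
move=> of_ x [i _ /of_[U BU sU]]; exists U => // y /sU ?.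
by exists i.
Qed.

HB.instance Definition _ :=
  isOpenTopological.Build (utop hB) uopenT uopenI uopen_bigU.

End uniform_topology.

(* [M^k] with the product topology. *)
Definition pow_top (L : language) (M : structure L)
    (B : set (set (home_set M * home_set M))) (hB : uniform_structure B)
    (k : nat) : topologicalType :=
  prod_topology (fun _ : 'I_k => utop hB).

Definition close_tuples (L : language) (M : structure L) (k : nat)
    (U : set (home_set M * home_set M)) (x y : pow M k) :=
  forall i, U (x i, y i).

(** * acl-dimension *)

Definition acl (L : language) (M : structure L) (C : set (elt M)) :
    set (elt M) :=
  [set a | exists p : pformula C (fun _ : 'I_1 => projT1 a),
     psat p (fun=> projT2 a) /\ finite_set [set v | psat p v]].

Definition home_elt (L : language) (M : structure L) (a : home_set M) :
  elt M := existT _ (home L) a.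

(* The subtuple of [a] with index set [J] generates [a] over [C]. *)
Definition acl_spans (L : language) (M : structure L) (C : set (elt M))
    (k : nat) (a : pow M k) (J : {set 'I_k}) :=
  forall i, acl (C `|` [set home_elt (a j) | j in [set` J]]) (home_elt (a i)).

(* dim(a/C). The default value [k] of the minimum is attained, by the full
   tuple. *)
Definition dim_tuple (L : language) (M : structure L) (C : set (elt M))
    (k : nat) (a : pow M k) : nat :=
  \big[minn/k]_(J : {set 'I_k} | `[< acl_spans C a J >]) #|J|%N.

(* dim(A) computed over [C]; [dim_tuple C a <= k] for all [a], so that the
   maximum may be taken over [l <= k]. *)
Definition dim_over (L : language) (M : structure L) (C : set (elt M))
    (k : nat) (A : set (pow M k)) : \bar int :=
  if `[< A = set0 >] then -oo%E
  else (Posz (\max_(l < k.+1 | `[< exists2 a, A a & dim_tuple C a = l >]) l))%:E.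

(* dim(A) for a definable set [A], computed over a chosen small parameter set
   over which [A] is definable; the value does not depend on that choice. *)
Definition acl_dim (L : language) (M : structure L) (k : nat)
    (A : set (pow M k)) : \bar int :=
  dim_over (xget set0 [set C | small C /\ definable_over C A]) A.

Definition almost_all (L : language) (M : structure L) (k : nat)
    (B A : set (pow M k)) :=
  [/\ definable B, B `<=` A & A = set0 \/ (acl_dim (A `\` B) < acl_dim A)%E].

Definition holds_ae (L : language) (M : structure L) (k : nat)
    (A : set (pow M k)) (P : pow M k -> Prop) :=
  exists2 B, almost_all B A & forall x, B x -> P x.

(** * Correspondences *)

(* [f] is the graph; [xsection f x] is the finite set f(x). *)
Definition correspondence (L : language) (M : structure L) (k l : nat)
    (E : set (pow M k)) (F : set (pow M l)) (f : set (pow M k * pow M l)) :=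
  [/\ definable E, definable F, f `<=` E `*` F,
      definable [set vcat xy.1 xy.2 | xy in f] &
      forall x, E x -> finite_set (xsection f x) /\ xsection f x !=set0].

Definition close_sets (L : language) (M : structure L) (l : nat)
    (U : set (home_set M * home_set M)) (S S' : set (pow M l)) :=
  (forall y, S y -> exists2 y', S' y' & close_tuples U y y') /\
  (forall y', S' y' -> exists2 y, S y & close_tuples U y y').

Definition corr_continuous_at (L : language) (M : structure L)
    (B : set (set (home_set M * home_set M))) (k l : nat)
    (E : set (pow M k)) (f : set (pow M k * pow M l)) (x : pow M k) :=
  forall W, B W -> exists2 U, B U &
    forall x', E x' -> close_tuples U x x' ->
      close_sets W (xsection f x) (xsection f x').

(* Main.v *)
Require Import Defs.
From mathcomp Require Import all_boot all_order all_algebra.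
From mathcomp Require Import all_classical all_reals all_analysis.
From mathcomp Require Import zify.

(* A definable [A] in M^n without interior is covered by finitely many definable
   sets, the i-th of which has boundedly many points on every line in direction i
   ([thin_cover]). By induction on n: the points (y, x') of [A] with y not interior
   to the fibre over x' are finitely many on each line in direction 0; the others
   form, for fixed y, a directed union of sets without interior, which contains no
   large finite grid because none of its members does, so the induction hypothesis
   applies. Grids also show that the sets without interior form an ideal, closed
   under definable directed unions.

   [acl_dim] is computed over a parameter set that need not define the uniform
   structure, so the cover has to be definable without its parameters c0. Two
   parameters c, c' satisfying a suitable formula true of c0 give topologies whose
   germs differ at boundedly many points. Among finite tuples of such parameters,
   those with nearly maximal average disagreement cannot be unanimous on two
   different germs at the same point; the germ on which one of them is unanimous
   is therefore definable without parameters, and is that of c0 off a finite set.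

   For a fixed entourage U, f is U-constant on some box. In one variable, some
   ball of M^l of radius U meets f(x) for infinitely many x; remove it from f(x)
   and induct on the number of values. In n + 1 variables, a box and a uniform
   radius can be found on which f hardly depends on the first variable, and
   the case of n variables applies to a slice. Hence the discontinuities, a
   directed union over U, have no interior. *)

Set Implicit Arguments.
Unset Strict Implicit.
Unset Printing Implicit Defensive.

Local Open Scope classical_set_scope.

(** * Definability *)

Section substitution.
Context {L : language}.

Fixpoint tsubst (I J : Type) (G : I -> lsort L) (H : J -> lsort L)
    (r : forall i, term H (G i)) (s : lsort L) (t : term G s) : term H s :=
  match t in term _ s return term H s with
  | TVar i => r i
  | TApp f t => TApp (fun j => tsubst r (t j))
  end.

Definition tweak (J : Type) (H : J -> lsort L) (s0 s : lsort L)
    (t : term H s) : term (oapp H s0) s :=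
  tsubst (fun j => @TVar L (option J) (oapp H s0) (Some j)) t.

Definition subst_lift (I J : Type) (G : I -> lsort L) (H : J -> lsort L)
    (s : lsort L) (r : forall i, term H (G i)) :
    forall o, term (oapp H s) (oapp G s o) :=
  fun o => match o return term (oapp H s) (oapp G s o) with
           | Some i => tweak s (r i)
           | None => @TVar L (option J) (oapp H s) None
           end.

Fixpoint fsubst (I : Type) (G : I -> lsort L) (p : formula G) :
    forall (J : Type) (H : J -> lsort L), (forall i, term H (G i)) -> formula H :=
  match p with
  | FEq s t u => fun J H r => FEq (tsubst r t) (tsubst r u)
  | FRel R t => fun J H r => FRel (fun j => tsubst r (t j))
  | FNeg p => fun J H r => FNeg (fsubst p r)
  | FAnd p q => fun J H r => FAnd (fsubst p r) (fsubst q r)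
  | FEx s p => fun J H r => FEx (fsubst p (subst_lift s r))
  end.

Variable M : structure L.

Lemma teval_subst (I J : Type) (G : I -> lsort L) (H : J -> lsort L)
    (r : forall i, term H (G i)) (v : asg M H) (s : lsort L) (t : term G s) :
  teval v (tsubst r t) = teval (fun i => teval v (r i)) t.
Proof. by elim: t => //= f t IH; congr func_interp; apply/functional_extensionality_dep. Qed.

Lemma sat_subst (I J : Type) (G : I -> lsort L) (p : formula G)
    (H : J -> lsort L) (r : forall i, term H (G i)) (v : asg M H) :
  sat (fsubst p r) v <-> sat p (fun i => teval v (r i)).
Proof.
elim: p J H r v => {I G} [I G s t u|I G R t|I G p IH|I G p IHp q IHq|I G s p IH] J H r v /=.
- by rewrite !teval_subst.
- suff -> : (fun j => teval v (tsubst r (t j))) =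
            (fun j => teval (fun i => teval v (r i)) (t j)) by [].
  by apply/functional_extensionality_dep => j; rewrite teval_subst.
- by split => h /IH.
- by rewrite IHp IHq.
- suff e a : (fun i => teval (asg_extend v a) (subst_lift s r i)) =
             asg_extend (fun i => teval v (r i)) a.
    by split => -[a]; [move/IH; rewrite e|rewrite -e => /IH]; exists a.
  apply/functional_extensionality_dep => -[i|] //=.
  by rewrite /tweak teval_subst.
Qed.

(* The cast disappears under evaluation, see [teval_cast]. *)
Definition tvar_cast (I J : Type) (G : I -> lsort L) (f : J -> I) (j : J) (i : I)
    (e : f j = i) : term (G \o f) (G i) :=
  match e in _ = i return term (G \o f) (G i) with
  | erefl => @TVar L J (G \o f) j
  end.

Lemma teval_cast (I J : Type) (G : I -> lsort L) (f : J -> I) (j : J) (i : I)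
    (e : f j = i) (v : asg M G) :
  teval (fun j => v (f j) : M ((G \o f) j)) (tvar_cast G e) = v i.
Proof. by case: _ / e. Qed.

Lemma asg_reindex (I J : Type) (G : I -> lsort L) (f : J -> I) (g : I -> J) :
  cancel f g -> cancel g f ->
  forall w : asg M (G \o f), exists v : asg M G, w = fun j => v (f j).
Proof.
move=> fK gK w.
exists (fun i => match gK i in _ = i return M (G i) with erefl => w (g i) end).
apply/functional_extensionality_dep => j.
(* After rewriting, the transport is along a loop at [f j], and proof irrelevance makes it the
   identity. *)
move: (gK (f j)); rewrite fK => e.
by rewrite (Prop_irrelevance e erefl).
Qed.

End substitution.

(** * Sets definable without parameters, and maps given by terms *)

Section definability.
Context {L : language} (M : structure L).

(** [FEx] binds one variable at a time; this is quantification over a whole block of variables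
    indexed by [J]. *)
Definition qfin (J : Type) := forall (I : Type) (G : I -> lsort L)
    (H : J -> lsort L) (p : formula (sum_sort G H)), exists q : formula G,
  forall v : asg M G, sat q v <-> exists w : asg M H, sat p (vcat v w).

Lemma qfin_void : qfin void.
Proof.
move=> I G H p.
pose r (x : I + void) : term G (sum_sort G H x) :=
  match x with inl i => TVar G i | inr j => match j with end end.
exists (fsubst p r) => v.
have e w : (fun i => teval v (r i)) = vcat v w.
  by apply/functional_extensionality_dep => -[].
split.
- move/sat_subst => h; exists (fun j : void => match j with end).
  by rewrite -(e (fun j : void => match j with end)).
- by case=> w h; apply/sat_subst; rewrite (e w).
Qed.

Lemma qfin_option J : qfin J -> qfin (option J).
Proof.
move=> qJ I G H p.
pose H' (j : J) := H (Some j).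
pose r (x : I + option J) : term (oapp (sum_sort G H') (H None)) (sum_sort G H x) :=
  match x return term (oapp (sum_sort G H') (H None)) (sum_sort G H x) with
  | inl i => @TVar L (option (I + J)) (oapp (sum_sort G H') (H None)) (Some (inl i))
  | inr (Some j) => @TVar L (option (I + J)) (oapp (sum_sort G H') (H None)) (Some (inr j))
  | inr None => @TVar L (option (I + J)) (oapp (sum_sort G H') (H None)) None
  end.
have [q hq] := qJ I G H' (FEx (fsubst p r)).
exists q => v; rewrite hq; split.
- move=> [w [a /sat_subst h]].
  pose w' o := match o return M (H o) with Some j => w j | None => a end.
  exists w'.
  suff <- : (fun i => teval (asg_extend (vcat v w) a) (r i)) = vcat v w' by [].
  by apply/functional_extensionality_dep => -[|[]].
- move=> [w h]; exists (fun j => w (Some j)), (w None); apply/sat_subst.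
  suff -> : (fun i => teval (asg_extend (vcat v (fun j => w (Some j))) (w None)) (r i))
     = vcat v w by [].
  by apply/functional_extensionality_dep => -[|[]].
Qed.

Lemma qfin_bij (J K : Type) (f : J -> K) (g : K -> J) :
  cancel f g -> cancel g f -> qfin J -> qfin K.
Proof.
move=> fK gK qJ I G H p.
pose h (x : I + J) : I + K := match x with inl i => inl i | inr j => inr (f j) end.
pose S := sum_sort G (H \o f).
pose r (x : I + K) : term S (sum_sort G H x) :=
  match x return term S (sum_sort G H x) with
  | inl i => @TVar L _ S (inl i)
  | inr k => tsubst (fun j => @TVar L _ S (inr j)) (tvar_cast H (gK k))
  end.
have [q hq] := qJ I G (H \o f) (fsubst p r).
have e v (w : asg M H) :
    (fun i => teval (vcat v (fun j => w (f j) : M ((H \o f) j))) (r i)) = vcat v w.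
  apply/functional_extensionality_dep => -[//|k] /=.
  by rewrite teval_subst /= teval_cast.
exists q => v; rewrite hq; split.
- move=> [w]; have [w' ->] := asg_reindex fK gK w.
  by move/sat_subst; rewrite e; exists w'.
- by move=> [w hw]; exists (fun j => w (f j)); apply/sat_subst; rewrite e.
Qed.

Lemma qfin_ord n : qfin 'I_n.
Proof.
elim: n => [|n IH].
  have f : 'I_0 -> void by case.
  by apply: (@qfin_bij void _ (fun j : void => match j with end) f);
    [case|case|exact: qfin_void].
apply: (@qfin_bij (option 'I_n) _ (fun o => oapp (lift ord0) ord0 o) (unlift ord0)).
- by case=> [j|] /=; rewrite ?liftK ?unlift_none.
- by move=> j; case: unliftP.
- exact: qfin_option.
Qed.

Lemma qfin_finType (J : finType) : qfin J.
Proof. exact: (qfin_bij (@enum_valK J) (@enum_rankK J) (@qfin_ord _)). Qed.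

(* The types in canonical bijection with the tuples of elements of [M] of some
   given finite list of sorts. *)
Record dty := Dty {
  car :> Type;
  dix : finType;
  dsrt : dix -> lsort L;
  enc : car -> asg M dsrt;
  dec : asg M dsrt -> car;
  encK : cancel enc dec;
  decK : cancel dec enc }.

Canonical dty_asg (J : finType) (H : J -> lsort L) : dty :=
  @Dty (asg M H) J H id id (fun=> erefl) (fun=> erefl).

Program Canonical dty_el (s : lsort L) : dty :=
  @Dty (M s) unit (fun=> s) (fun a _ => a) (fun v => v tt) _ _.
Next Obligation. by []. Qed.
Next Obligation. by move=> s v; apply/functional_extensionality_dep => -[]. Qed.

Program Canonical dty_prod (Z1 Z2 : dty) : dty :=
  @Dty (Z1 * Z2)%type _ (sum_sort (@dsrt Z1) (@dsrt Z2))
    (fun z => vcat (enc z.1) (enc z.2))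
    (fun v => (dec (fun i => v (inl i)), dec (fun i => v (inr i)))) _ _.
Next Obligation. by move=> Z1 Z2 [a b]; rewrite /= !encK. Qed.
Next Obligation.
by move=> Z1 Z2 v; apply/functional_extensionality_dep => -[i|i] /=; rewrite decK.
Qed.

(* No parameters are allowed in the formula: they are treated as further
   variables, so that a definable family and its members are handled uniformly. *)
Definition dset (Z : dty) (A : Z -> Prop) :=
  exists p : formula (@dsrt Z), forall z, A z <-> sat p (enc z).

(** Coordinates are terms, which is stronger than having a definable graph: preimages are then plain
    substitutions, without quantifiers. *)
Definition dmap (Z Z' : dty) (f : Z -> Z') :=
  forall j, exists t : term (@dsrt Z) (@dsrt Z' j),
    forall z, enc (f z) j = teval (enc z) t.

Lemma dset_ext (Z : dty) (A A' : Z -> Prop) :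
  (forall z, A z <-> A' z) -> dset A -> dset A'.
Proof. by move=> e [p hp]; exists p => z; rewrite -e. Qed.

Lemma dset_comp (Z Z' : dty) (f : Z -> Z') (A : Z' -> Prop) :
  dset A -> dmap f -> dset (fun z => A (f z)).
Proof.
move=> [p hp] df; pose t j := sval (cid (df j)).
have ht j : forall z, enc (f z) j = teval (enc z) (t j) by exact: svalP (cid (df j)).
exists (fsubst p t) => z.
rewrite hp sat_subst.
by have -> : enc (f z) = (fun i => teval (enc z) (t i))
  by apply/functional_extensionality_dep => j; rewrite ht.
Qed.

Lemma dmap_id (Z : dty) : dmap (fun z : Z => z).
Proof. by move=> j; exists (TVar _ j). Qed.

Lemma dmap_comp (Z Z' Z'' : dty) (f : Z -> Z') (g : Z' -> Z'') :
  dmap f -> dmap g -> dmap (fun z => g (f z)).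
Proof.
move=> df dg j; have [u hu] := dg j; pose t i := sval (cid (df i)).
have ht i : forall z, enc (f z) i = teval (enc z) (t i) by exact: svalP (cid (df i)).
exists (tsubst t u) => z; rewrite hu teval_subst.
by have -> : enc (f z) = (fun i => teval (enc z) (t i))
  by apply/functional_extensionality_dep => i; rewrite ht.
Qed.

Lemma dmap_fst (Z Z1 Z2 : dty) (f : Z -> Z1 * Z2) :
  dmap f -> dmap (fun z => (f z).1).
Proof. by move=> df j; have [t ht] := df (inl j); exists t. Qed.

Lemma dmap_snd (Z Z1 Z2 : dty) (f : Z -> Z1 * Z2) :
  dmap f -> dmap (fun z => (f z).2).
Proof. by move=> df j; have [t ht] := df (inr j); exists t. Qed.

Lemma dmap_pair (Z Z1 Z2 : dty) (f : Z -> Z1) (g : Z -> Z2) :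
  dmap f -> dmap g -> dmap (fun z => (f z, g z)).
Proof.
by move=> df dg [j|j]; [have [t ht] := df j|have [t ht] := dg j]; exists t.
Qed.

Lemma dmap_asg (Z : dty) (J : finType) (H : J -> lsort L) (f : Z -> asg M H) :
  (forall j, dmap (fun z => f z j)) -> dmap f.
Proof. by move=> df j; have [t ht] := df j tt; exists t. Qed.

Lemma dmap_proj (Z : dty) (J : finType) (H : J -> lsort L) (f : Z -> asg M H) j :
  dmap f -> dmap (fun z => f z j).
Proof. by move=> df []; have [t ht] := df j; exists t. Qed.

Lemma dset_not (Z : dty) (A : Z -> Prop) : dset A -> dset (fun z => ~ A z).
Proof. by move=> [p hp]; exists (FNeg p) => z; rewrite hp. Qed.

Lemma dset_and (Z : dty) (A A' : Z -> Prop) :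
  dset A -> dset A' -> dset (fun z => A z /\ A' z).
Proof. by move=> [p hp] [q hq]; exists (FAnd p q) => z; rewrite hp hq. Qed.

Lemma dset_or (Z : dty) (A A' : Z -> Prop) :
  dset A -> dset A' -> dset (fun z => A z \/ A' z).
Proof.
move=> dA dA'; apply: (dset_ext _ (dset_not (dset_and (dset_not dA) (dset_not dA')))) => z.
by rewrite not_andE !not_notE.
Qed.

Lemma dset_imp (Z : dty) (A A' : Z -> Prop) :
  dset A -> dset A' -> dset (fun z => A z -> A' z).
Proof.
move=> dA dA'; apply: (dset_ext _ (dset_or (dset_not dA) dA')) => z.
by split => [[]//|h]; have [/h|] := pselect (A z); [right|left].
Qed.

Lemma dset_ex (Z Z' : dty) (A : Z -> Z' -> Prop) :
  dset (fun z : Z * Z' => A z.1 z.2) -> dset (fun z => exists z', A z z').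
Proof.
move=> [p hp]; have [q hq] := qfin_finType p.
exists q => z; rewrite hq; split => -[z' h].
- by exists (enc z'); apply/(hp (z, z')).
- by exists (dec z'); apply/(hp (z, dec z')); rewrite /= decK.
Qed.

Lemma dset_all (Z Z' : dty) (A : Z -> Z' -> Prop) :
  dset (fun z : Z * Z' => A z.1 z.2) -> dset (fun z => forall z', A z z').
Proof.
move=> dA.
have dN := @dset_not _ (fun p : Z * Z' => A p.1 p.2) dA.
apply: (dset_ext _ (dset_not (@dset_ex Z Z' (fun z z' => ~ A z z') dN))) => z.
by split => [h z'|h [z' /(_ (h z'))//]]; apply: contrapT => h'; apply: h; exists z'.
Qed.

(** Classically the proposition is true or false, and both truth values are formulas. Facts of the
    metatheory may thus occur inside definable sets without becoming parameters. *)
Lemma dset_const (Z : dty) (P : Prop) : dset (fun _ : Z => P).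
Proof.
have T : dset (fun _ : Z => True).
  (* Truth is expressed by [exists x, x = x], valid because sorts are inhabited. *)
  pose x := @TVar L _ (oapp (@dsrt Z) (home L)) None.
  exists (FEx (FEq x x)) => z; split => // _ /=.
  by have [a] := carrier_inhabited M (home L); exists a.
have [p|np] := pselect P; first exact: (dset_ext _ T).
by apply: (dset_ext _ (dset_not T)) => z; tauto.
Qed.

Lemma dset_fin_all (Z : dty) (I : finType) (A : I -> Z -> Prop) :
  (forall i, dset (A i)) -> dset (fun z => forall i, A i z).
Proof.
move=> dA.
suff h (s : seq I) : dset (fun z => forall i, i \in s -> A i z).
  by apply: (dset_ext _ (h (enum I))) => z; split=> H i *; apply: H; rewrite ?mem_enum.
elim: s => [|i s IH]; first by apply: (dset_ext _ (dset_const _ True)).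
apply: (dset_ext _ (dset_and (dA i) IH)) => z; split.
  by move=> [h1 h2] j; rewrite inE => /predU1P[->//|]; exact: h2.
by move=> h; split => [|j js]; apply: h; rewrite inE ?eqxx ?js ?orbT.
Qed.

End definability.

(** * Counting up to a fixed number *)

Section many.

(** The first-order approximations to infinitude: each [many N] is expressed by a formula, and a set
    is infinite exactly when all of them hold. *)
Definition many (T : Type) (N : nat) (S : set T) :=
  exists g : 'I_N -> T, injective g /\ forall i, S (g i).

Lemma many_sub (T : Type) N (S S' : set T) : S `<=` S' -> many N S -> many N S'.
Proof. by move=> sS [g [ig Sg]]; exists g; split => // i; apply: sS. Qed.

Lemma many_card (T : Type) (I : finType) (A : {set I}) (g : I -> T) (S : set T) N :
  injective g -> (forall i, i \in A -> S (g i)) -> (N <= #|A|)%N -> many N S.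
Proof.
move=> ig Sg leN; exists (fun i => g (enum_val (widen_ord leN i))); split.
  by move=> i j /ig /enum_val_inj e; apply/val_inj/(congr1 val e).
by move=> i; apply: Sg; exact: enum_valP.
Qed.

Lemma many_leq (T : Type) N m (S : set T) : (m <= N)%N -> many N S -> many m S.
Proof.
move=> le [g [ig Sg]]; apply: (@many_card _ _ [set: 'I_N]%SET g) => //.
by rewrite cardsT card_ord.
Qed.

Lemma manyU (T : Type) a b (S S' : set T) :
  many (a + b) (S `|` S') -> many a S \/ many b S'.
Proof.
move=> [g [ig Sg]]; pose A := [set i | `[< S (g i) >]]%SET.
have [le|lt] := leqP a #|A|.
  by left; apply: (@many_card _ _ A g) => // i; rewrite inE => /asboolP.
right; apply: (@many_card _ _ (~: A) g) => //.
  by move=> i; rewrite !inE => /asboolP h; case: (Sg i).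
have := cardsC A; rewrite card_ord => e.
by rewrite -(leq_add2l #|A|) e leq_add2r ltnW.
Qed.

Lemma infinite_many (T : Type) N (S : set T) : infinite_set S -> many N S.
Proof.
move=> /(@infinite_set_fset {classic T} _ N)[B BS leN].
pose s : seq {classic T} := finmap.enum_fset B.
have us : uniq (in_tuple s) by exact: finmap.fset_uniq.
exists (fun i : 'I_N => tnth (in_tuple s) (widen_ord leN i)); split.
  by move=> i j /(tuple_uniqP _ us) /(congr1 val) e; apply/val_inj.
by move=> i; apply: BS => /=; exact: mem_tnth.
Qed.

Lemma finite_enum (T : Type) (S : set T) : finite_set S ->
  exists n (g : 'I_n -> T), (forall i, S (g i)) /\ forall x, S x -> exists i, g i = x.
Proof.
move=> /(@finite_seqP {classic T})[s ->]; exists (size s), (tnth (in_tuple s)).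
split=> [i|x /= xs]; first exact: mem_tnth.
by have /tnthP[i ->] : x \in in_tuple s by []; exists i.
Qed.

Lemma many_finType (T : Type) (I : finType) (S : set T) (g : I -> T) N :
  (forall x, S x -> exists i, g i = x) -> many N S -> (N <= #|I|)%N.
Proof.
move=> sg [h [ih Sh]]; have /choice[k hk] := fun i => sg _ (Sh i).
have ik : injective k by move=> i j e; apply: ih; rewrite -!hk e.
by rewrite -(card_ord N); exact: leq_card ik.
Qed.

Lemma many_infinite (T : Type) (S : set T) : (forall N, many N S) -> infinite_set S.
Proof.
move=> h /finite_enum[n [g [_ sg]]].
by have := many_finType sg (h n.+1); rewrite card_ord ltnn.
Qed.

Lemma finite_notmany (T : Type) (S : set T) : finite_set S <-> exists N, ~ many N S.
Proof.
split; last by move=> [N]; apply: contra_notP => /(infinite_many N).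
by apply: contraPP => h; apply: many_infinite => N; apply: contrapT => hN; apply: h; exists N.
Qed.

End many.

(** * Parameters as values of extra variables *)

Section parameters.
Context {L : language} (M : structure L).

Lemma term_finite_support (I : Type) (G : I -> lsort L) s (t : term G s) :
  exists (J : finType) (r : J -> I) (t' : term (G \o r) s),
    forall v : asg M G, teval v t = teval (fun j => v (r j) : M ((G \o r) j)) t'.
Proof.
elim: t => [i|f t IH].
  by exists unit, (fun=> i), (@TVar L unit (G \o fun=> i) tt).
pose J j := sval (cid (IH j)).
have hJ j : exists (r : J j -> I) (t' : term (G \o r) (funsym_dom j)),
    forall v : asg M G, teval v (t j) = teval (fun k => v (r k) : M ((G \o r) k)) t'.
  exact: svalP (cid (IH j)).
pose r j := sval (cid (hJ j)).
have hr j : exists t' : term (G \o r j) (funsym_dom j),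
    forall v : asg M G, teval v (t j) = teval (fun k => v (r j k) : M ((G \o r j) k)) t'.
  exact: svalP (cid (hJ j)).
pose t' j := sval (cid (hr j)).
have ht j : forall v : asg M G,
    teval v (t j) = teval (fun k => v (r j k) : M ((G \o r j) k)) (t' j).
  exact: svalP (cid (hr j)).
pose R (x : {j & J j}) := r (projT1 x) (projT2 x).
exists {j & J j}, R, (TApp (fun j => tsubst
  (fun k => @TVar L _ (G \o R) (existT _ j k)) (t' j))) => v /=.
congr func_interp; apply/functional_extensionality_dep => j.
by rewrite teval_subst ht.
Qed.

(** A formula mentions finitely many variables even when [I] is infinite. As parameters are extra
    variables, it mentions finitely many of them. *)
Lemma finite_support (I : Type) (G : I -> lsort L) (p : formula G) :
  exists (J : finType) (r : J -> I) (p' : formula (G \o r)),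
    forall v : asg M G, sat p v <-> sat p' (fun j => v (r j) : M ((G \o r) j)).
Proof.
elim: p => {I G} [I G s t u|I G R t|I G p [J [r [p' hp]]]
    |I G p [J [r [p' hp]]] q [K [r' [q' hq]]]|I G s p [J [r [p' hp]]]].
- have [J [r [t' ht]]] := term_finite_support t.
  have [K [r' [u' hu]]] := term_finite_support u.
  pose R (x : J + K) := match x with inl j => r j | inr k => r' k end.
  exists (J + K)%type, R, (FEq (tsubst (fun j => @TVar L _ (G \o R) (inl j)) t')
    (tsubst (fun j => @TVar L _ (G \o R) (inr j)) u')) => v /=.
  by rewrite !teval_subst ht hu.
- pose J j := sval (cid (term_finite_support (t j))).
  have hJ j : exists (r : J j -> I) (t' : term (G \o r) (relsym_dom j)),
      forall v : asg M G, teval v (t j) = teval (fun k => v (r k) : M ((G \o r) k)) t'.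
    exact: svalP (cid (term_finite_support (t j))).
  pose r j := sval (cid (hJ j)).
  have hr j : exists t' : term (G \o r j) (relsym_dom j),
      forall v : asg M G, teval v (t j) = teval (fun k => v (r j k) : M ((G \o r j) k)) t'.
    exact: svalP (cid (hJ j)).
  pose t' j := sval (cid (hr j)).
  have ht j : forall v : asg M G,
      teval v (t j) = teval (fun k => v (r j k) : M ((G \o r j) k)) (t' j).
    exact: svalP (cid (hr j)).
  pose S (x : {j & J j}) := r (projT1 x) (projT2 x).
  exists {j & J j}, S, (FRel (fun j => tsubst
    (fun k => @TVar L _ (G \o S) (existT _ j k)) (t' j))) => v /=.
  suff -> : (fun j => teval v (t j)) = (fun j => teval (fun j => v (S j) : M ((G \o S) j))
    (tsubst (fun k => @TVar L _ (G \o S) (existT _ j k)) (t' j))) by [].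
  by apply/functional_extensionality_dep => j; rewrite teval_subst ht.
- by exists J, r, (FNeg p') => v /=; rewrite hp.
- pose R (x : J + K) := match x with inl j => r j | inr k => r' k end.
  exists (J + K)%type, R, (FAnd (fsubst p' (fun j => @TVar L _ (G \o R) (inl j)))
    (fsubst q' (fun j => @TVar L _ (G \o R) (inr j)))) => v /=.
  by rewrite !sat_subst hp hq.
(* [K] omits the positions held by the bound variable, of which there may be several or none. *)
- pose K := {j : J | isSome (r j)}.
  have get (k : K) : {i | r (val k) = Some i}.
    by case: k => j /=; case: (r j) => // i _; exists i.
  pose r' (k : K) := sval (get k).
  have rr' (k : K) : r (val k) = Some (r' k) := svalP (get k).
  have e j i (e : r j = Some i) : {k : K | val k = j & r' k = i}.
    have h : isSome (r j) by rewrite e.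
    exists (exist (fun j => isSome (r j)) j h) => //.
    by have := rr' (exist (fun j => isSome (r j)) j h); rewrite /= e => -[].
  have sub o j : r j = o -> {t : term (oapp (G \o r') s) (oapp G s o) |
      forall (v : asg M G) a, teval (asg_extend (fun k => v (r' k) : M ((G \o r') k)) a) t
        = asg_extend v a o}.
    case: o => [i|] ej.
      have [k _ ei] := e _ _ ej.
      exists (tweak s (tvar_cast G ei)) => v a.
      by rewrite /tweak teval_subst /= teval_cast.
    by exists (@TVar L (option K) (oapp (G \o r') s) None).
  exists K, r', (FEx (fsubst p' (fun j => sval (sub (r j) j erefl)))) => v /=.
  have ev a : (fun j => teval (asg_extend (fun k => v (r' k) : M ((G \o r') k)) a)
       (sval (sub (r j) j erefl))) = (fun j => asg_extend v a (r j)).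
    apply/functional_extensionality_dep => j; exact: (svalP (sub (r j) j erefl)).
  split=> -[a].
    by move/hp => h; exists a; apply/sat_subst; rewrite ev.
  by move/sat_subst; rewrite ev => h; exists a; apply/hp.
Qed.

Definition dset_over (C : set (elt M)) (Z : dty M) (A : Z -> Prop) :=
  exists (Zc : dty M) (c : Zc) (A' : Zc * Z -> Prop),
    [/\ dset A', forall j, C (existT _ (dsrt j) (enc c j)) & forall z, A z <-> A' (c, z)].

(** The finitely many parameters of a formula are collected into a tuple [c], so that a set
    definable over [C] is the fibre over [c] of a family definable without parameters. *)
Lemma definable_overP (C : set (elt M)) (J : finType) (G : J -> lsort L)
    (A : set (asg M G)) : definable_over C A <-> dset_over C (A : dty_asg M G -> Prop).
Proof.
split=> [[p ->]|[Zc [c [A' [[p hp] cC hA]]]]].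
  have [K [r [p' hp]]] := finite_support p.
  pose is_r (x : J + param C) := if x is inr _ then true else false.
  pose K' := {k : K | is_r (r k)}.
  have get (k : K') : {i | r (val k) = inr i}.
    by case: k => j /=; case: (r j) => // i _; exists i.
  pose r' (k : K') := sval (get k).
  have rr' (k : K') : r (val k) = inr (r' k) := svalP (get k).
  have e j i (e : r j = inr i) : {k : K' | r' k = i}.
    have h : is_r (r j) by rewrite e.
    exists (exist (fun j => is_r (r j)) j h) => //.
    by have := rr' (exist (fun j => is_r (r j)) j h); rewrite /= e => -[].
  pose P := @param_sort L M C.
  pose S := sum_sort (P \o r') G.
  have sub x k : r k = x -> {t : term S (sum_sort G P x) |
      forall v : asg M G, teval (vcat (fun k => @param_val L M C (r' k) : M ((P \o r') k)) v) t
        = vcat v (@param_val L M C) x}.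
    case: x => [i|i] ej; first by exists (@TVar L _ S (inr i)).
    have [k' ei] := e _ _ ej.
    exists (tsubst (fun k => @TVar L _ S (inl k)) (tvar_cast P ei)) => v.
    by rewrite teval_subst /= teval_cast.
  exists (dty_asg M (P \o r')), (fun k => @param_val L M C (r' k)).
  pose q := fsubst p' (fun k => sval (sub (r k) k erefl)).
  exists (fun z => sat q (vcat z.1 z.2)); split.
  - by exists q.
  - by move=> j /=; case: (r' j) => -[].
  - move=> v /=; rewrite /psat hp sat_subst.
    set w1 := (X in sat _ X); set w2 := (X in _ <-> sat _ X).
    suff -> : w1 = w2 by [].
    apply/functional_extensionality_dep => k.
    by rewrite /w1 /w2 (svalP (sub (r k) k erefl)).
pose S := sum_sort G (@param_sort L M C).
pose r (x : dix Zc + J) : term S (sum_sort (@dsrt _ _ Zc) G x) :=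
  match x return term S (sum_sort (@dsrt _ _ Zc) G x) with
  | inl j => @TVar L _ S (inr (exist _ _ (cC j)))
  | inr i => @TVar L _ S (inl i)
  end.
exists (fsubst p r); apply/funext => v; apply/propext.
rewrite (hA v) hp /psat /= sat_subst.
set w1 := (X in sat _ X); set w2 := (X in _ <-> sat _ X).
suff -> : w1 = w2 by [].
by apply/functional_extensionality_dep => -[].
Qed.

Definition range_elt (Z : dty M) (c : Z) : set (elt M) :=
  [set existT _ (dsrt j) (enc c j) | j in [set: dix Z]].

Lemma small_finite (C : set (elt M)) : finite_set C -> small C.
Proof.
move=> /finite_set_countable cC; apply: (card_le_trans cC).
pose g (x : nat + (lsort L + (funsym L + relsym L))) := if x is inl n then n else 0%N.
apply: (card_le_trans _ (card_image_le g setT)).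
by apply: subset_card_le => n _; exists (inl n).
Qed.

End parameters.

(** * Compactness arguments from saturation *)

Section saturation.
Context {L : language} (M : structure L) (M_saturated : saturated M).

Lemma saturated_asg (C : set (elt M)) (J : finType) (H : J -> lsort L)
    (Theta : Type) (A : Theta -> set (asg M H)) :
  small C -> (forall a, definable_over C (A a)) ->
  (forall n (g : 'I_n -> Theta), exists z, forall i, A (g i) z) ->
  exists z, forall a, A a z.
Proof.
move=> sC defA fA.
pose G := H \o (@enum_val J J).
pose P := @param_sort L M C.
pose S := sum_sort G P.
pose r (x : J + param C) : term S (sum_sort H P x) :=
  match x return term S (sum_sort H P x) with
  | inl j => tsubst (fun k => @TVar L _ S (inl k)) (tvar_cast H (enum_rankK j))
  | inr i => @TVar L _ S (inr i)
  end.
have key (p : pformula C H) (w : asg M H) :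
    psat (fsubst p r) (fun k => w (enum_val k) : M (G k)) <-> psat p w.
  rewrite /psat sat_subst.
  suff -> : (fun i => teval (vcat (fun k => w (enum_val k) : M (G k))
     (@param_val L M C)) (r i)) = vcat w (@param_val L M C) by [].
  apply/functional_extensionality_dep => -[j|//] /=.
  by rewrite teval_subst; exact: (teval_cast (enum_rankK j) w).
pose p a := sval (cid (defA a)).
have hp a : A a = [set v | psat (p a) v] := svalP (cid (defA a)).
pose Ps := range (fun a => fsubst (p a) r).
have /(_ _)[|v hv] := M_saturated (P := Ps) sC.
  move=> F /finite_enum[n [g [Fg sg]]] FP.
  have /choice[h hh] : forall i, exists a, fsubst (p a) r = g i.
    by move=> i; have [a _ ea] := FP _ (Fg i); exists a.
  have [z hz] := fA n h.
  exists (fun k => z (enum_val k)) => q /sg[i <-].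
  by rewrite -hh; apply/key; have := hz i; rewrite hp.
have [w e] := asg_reindex (@enum_valK J) (@enum_rankK J) v.
exists w => a; rewrite hp /=; apply/key; rewrite -e; apply: hv.
by exists a.
Qed.

Lemma dset_over_dec (C : set (elt M)) (Z : dty M) (A : Z -> Prop) :
  dset_over C A -> definable_over C [set w : asg M (@dsrt _ _ Z) | A (dec w)].
Proof.
move=> [Zc [c [A' [[p hp] cC hA]]]]; apply/definable_overP.
exists Zc, c, (fun q => A' (q.1, dec q.2)); split => //.
- exists p => -[a w]; rewrite hp /=.
  suff -> : vcat (enc a) (enc (dec w)) = vcat (enc a) w by [].
  by rewrite decK.
- by move=> w; exact: hA.
Qed.

Lemma saturated_dset (C : set (elt M)) (Z : dty M)
    (Theta : Type) (A : Theta -> set Z) :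
  small C -> (forall a, dset_over C (A a)) ->
  (forall n (g : 'I_n -> Theta), exists z, forall i, A (g i) z) ->
  exists z, forall a, A a z.
Proof.
move=> sC dA fA.
have [||w hw] := @saturated_asg C _ _ _ (fun a => [set w | A a (dec w)]) sC.
- by move=> a; exact: dset_over_dec.
- move=> n g; have [z hz] := fA n g; exists (enc z) => i /=.
  by rewrite encK; exact: hz.
by exists (dec w).
Qed.

Lemma finite_range_elt (Z : dty M) (c : Z) : finite_set (range_elt c).
Proof. exact/finite_image/finite_finset. Qed.

Lemma dset_over_range (Zc Z : dty M) (c : Zc) (A : Zc -> Z -> Prop) :
  dset (fun p => A p.1 p.2) -> dset_over (range_elt c) (A c).
Proof. by move=> dA; exists Zc, c, (fun p => A p.1 p.2); split => // j; exists j. Qed.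

(** For a decreasing sequence, finite satisfiability is nonemptiness of each term. Uniform bounds
    come from this: if every bound [n] fails somewhere, all of them fail at a single point. *)
Lemma saturated_seq (Zc Z : dty M) (c : Zc) (A : nat -> Zc -> Z -> Prop) :
  (forall n, dset (fun p => A n p.1 p.2)) ->
  (forall n z, A n.+1 c z -> A n c z) ->
  (forall n, exists z, A n c z) -> exists z, forall n, A n c z.
Proof.
move=> dA decA exA.
have mono m n z : (m <= n)%N -> A n c z -> A m c z.
  elim: n => [|n IH]; first by rewrite leqn0 => /eqP ->.
  by rewrite leq_eqVlt => /predU1P[->//|/IH h /decA].
apply: (@saturated_dset (range_elt c) Z nat (fun n => [set z | A n c z])).
- exact/small_finite/finite_range_elt.
- by move=> n; exact: (dset_over_range c (dA n)).
- move=> n g; have [z hz] := exA (\max_i g i)%N; exists z => i /=.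
  by apply: mono hz; exact: leq_bigmax.
Qed.

Lemma definable_dset (J : finType) (G : J -> lsort L) (A : set (asg M G)) :
  definable A -> exists (Zc : dty M) (c : Zc) (A' : Zc -> asg M G -> Prop),
    dset (fun p => A' p.1 p.2) /\ A = A' c.
Proof.
move=> /definable_overP[Zc [c [A' [dA' _ hA]]]].
exists Zc, c, (fun c z => A' (c, z)); split.
  by apply: (dset_ext _ dA') => -[].
by apply/funext => z; apply/propext; exact: hA.
Qed.

Lemma dset_definable (J : finType) (G : J -> lsort L) (Zc : dty M) (c : Zc)
    (A : Zc -> asg M G -> Prop) :
  dset (fun p => A p.1 p.2) -> definable [set z | A c z].
Proof.
by move=> dA; apply/definable_overP; exists Zc, c, (fun p => A p.1 p.2); split.
Qed.

Lemma definable_small (J : finType) (G : J -> lsort L) (A : set (asg M G)) :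
  definable A -> exists C, small C /\ definable_over C A.
Proof.
move=> /definable_dset[Zc [c [A' [dA' ->]]]]; exists (range_elt c); split.
  exact/small_finite/finite_range_elt.
by apply/definable_overP; exact: dset_over_range.
Qed.

End saturation.

(** * Finite tuples and substitution into relations *)

Section tuples.
Context {L : language} {M : structure L}.

(** Allows quantification over the witnesses of [many] and over finite tuples of parameters. *)
Program Definition dty_fun (I : finType) (Z : dty M) : dty M :=
  @Dty L M (I -> Z) (I * dix Z)%type (fun x => @dsrt _ _ Z x.2)
    (fun f x => enc (f x.1) x.2) (fun v i => dec (fun j => v (i, j))) _ _.
Next Obligation. move=> I Z f; apply/funext => i; exact: (encK (f i)). Qed.
Next Obligation.
by move=> I Z v; apply/functional_extensionality_dep => -[i j] /=; rewrite decK.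
Qed.

Lemma dmap_fun (I : finType) (Z Z' : dty M) (f : Z -> dty_fun I Z') i :
  dmap f -> dmap (fun z => (f z : I -> Z') i).
Proof. by move=> df j; have [t ht] := df (i, j); exists t => z; rewrite -ht. Qed.

Lemma dset1 (Z Z1 : dty M) (A : Z1 -> Prop) (f : Z -> Z1) :
  dset A -> dmap f -> dset (fun z => A (f z)).
Proof. exact: dset_comp. Qed.

Lemma dset2 (Z Z1 Z2 : dty M) (A : Z1 -> Z2 -> Prop) (f : Z -> Z1) (g : Z -> Z2) :
  dset (fun p : Z1 * Z2 => A p.1 p.2) -> dmap f -> dmap g ->
  dset (fun z => A (f z) (g z)).
Proof. by move=> dA df dg; exact: (dset_comp dA (dmap_pair df dg)). Qed.

Lemma dset3 (Z Z1 Z2 Z3 : dty M) (A : Z1 -> Z2 -> Z3 -> Prop)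
    (f : Z -> Z1) (g : Z -> Z2) (h : Z -> Z3) :
  dset (fun p : Z1 * Z2 * Z3 => A p.1.1 p.1.2 p.2) -> dmap f -> dmap g -> dmap h ->
  dset (fun z => A (f z) (g z) (h z)).
Proof.
by move=> dA df dg dh; exact: (dset_comp dA (dmap_pair (dmap_pair df dg) dh)).
Qed.

Lemma dset4 (Z Z1 Z2 Z3 Z4 : dty M) (A : Z1 -> Z2 -> Z3 -> Z4 -> Prop)
    (f : Z -> Z1) (g : Z -> Z2) (h : Z -> Z3) (k : Z -> Z4) :
  dset (fun p : Z1 * Z2 * Z3 * Z4 => A p.1.1.1 p.1.1.2 p.1.2 p.2) ->
  dmap f -> dmap g -> dmap h -> dmap k ->
  dset (fun z => A (f z) (g z) (h z) (k z)).
Proof.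
move=> dA df dg dh dk.
exact: (dset_comp dA (dmap_pair (dmap_pair (dmap_pair df dg) dh) dk)).
Qed.

Lemma dset_eqZ (Z Z' : dty M) (f g : Z -> Z') :
  dmap f -> dmap g -> dset (fun z => f z = g z).
Proof.
move=> df dg; apply: (@dset_ext _ _ _ (fun z => forall j, enc (f z) j = enc (g z) j)).
  move=> z; split => [h|-> //]; rewrite -(encK (f z)) -(encK (g z)).
  by congr dec; apply/functional_extensionality_dep.
apply: dset_fin_all => j; have [t ht] := df j; have [t' ht'] := dg j.
by exists (FEq t t') => z /=; rewrite ht ht'.
Qed.

End tuples.

(** * Coordinates in powers of the home sort *)

Section coordinates.
Context {L : language} {M : structure L}.
Local Notation HM := (home_set M).

Definition upd n (x : pow M n) (i : 'I_n) (y : HM) : pow M n :=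
  fun j => if j == i then y else x j.

Definition fcons n (y : HM) (x : pow M n) : pow M n.+1 :=
  fun i => if unlift ord0 i is Some j then x j else y.

Definition tail n (x : pow M n.+1) : pow M n := fun i => x (lift ord0 i).

Lemma pow_ext n (x y : pow M n) : (forall i, x i = y i) -> x = y.
Proof. exact: functional_extensionality_dep. Qed.

Lemma upd_id n (x : pow M n) i : upd x i (x i) = x.
Proof. by apply/pow_ext => j; rewrite /upd; case: eqP => [->|]. Qed.

Lemma upd_upd n (x : pow M n) i y y' : upd (upd x i y) i y' = upd x i y'.
Proof. by apply/pow_ext => j; rewrite /upd; case: eqP. Qed.

Lemma upd_same n (x : pow M n) i y : upd x i y i = y.
Proof. by rewrite /upd eqxx. Qed.

Lemma fcons_tail n (x : pow M n.+1) y : fcons y (tail x) = upd x ord0 y.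
Proof.
apply/pow_ext => i; rewrite /fcons /upd.
by case: (unliftP ord0 i) => [j|] ->; rewrite ?eqxx //= eq_liftF.
Qed.

Lemma fcons0 n y (x : pow M n) : fcons y x ord0 = y.
Proof. by rewrite /fcons unlift_none. Qed.

Lemma fconsS n y (x : pow M n) i : fcons y x (lift ord0 i) = x i.
Proof. by rewrite /fcons liftK. Qed.

Lemma tail_updS n (x : pow M n.+1) i y : tail (upd x (lift ord0 i) y) = upd (tail x) i y.
Proof. by apply/pow_ext => j; rewrite /tail /upd (inj_eq lift_inj). Qed.

Lemma dmap_coord (Z : dty M) n (f : Z -> pow M n) i :
  dmap f -> @dmap _ M Z (dty_el M (home L)) (fun z => f z i).
Proof. by move=> df; exact (dmap_proj (j:=i) df). Qed.

Lemma dmap_upd (Z : dty M) n i (f : Z -> pow M n) (g : Z -> HM) :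
  dmap f -> dmap g -> dmap (fun z => upd (f z) i (g z)).
Proof.
move=> df dg; apply: dmap_asg => j; rewrite /upd.
by case: eqP => _ //; exact: dmap_proj.
Qed.

Lemma dmap_fcons (Z : dty M) n (f : Z -> pow M n) (g : Z -> HM) :
  dmap f -> dmap g -> dmap (fun z => fcons (g z) (f z)).
Proof.
move=> df dg; apply: dmap_asg => j; rewrite /fcons.
case: (unlift ord0 j) => [k|]; [exact (dmap_proj (j:=k) df)|exact dg].
Qed.

Lemma dmap_tail (Z : dty M) n (f : Z -> pow M n.+1) :
  dmap f -> dmap (fun z => tail (f z)).
Proof. by move=> df; apply: dmap_asg => j; exact (dmap_proj (j:=lift ord0 j) df). Qed.

End coordinates.

(** Proves that a map built from projections, pairs and tuple operations is given by terms. For an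
    application, [dm_app] isolates the applied function as a map of [z] and passes it explicitly to
    the projection lemmas. *)
Ltac dm :=
  repeat (cbv beta; first [ assumption | lazymatch goal with
    | |- dmap (fun z => (_, _)) => apply: dmap_pair
    | |- dmap (fun z => upd _ _ _) => apply: dmap_upd
    | |- dmap (fun z => fcons _ _) => apply: dmap_fcons
    | |- dmap (fun z => tail _) => apply: dmap_tail
    | |- dmap (fun z => z) => apply: dmap_id
    | |- dmap (fun z => fst _) => apply: dmap_fst
    | |- dmap (fun z => snd _) => apply: dmap_snd
    | |- dmap fst => apply: dmap_fst
    | |- dmap snd => apply: dmap_snd
    | |- @dmap _ _ ?Z _ (fun z => _ _) => dm_app
    end ])
with dm_app :=
  lazymatch goal with
  | |- @dmap _ _ ?Z _ ?F =>
      let f := constr:(fun z : car Z =>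
        ltac:(let b := eval cbv beta in (F z) in
              lazymatch b with ?h _ => exact h end)) in
      first [ refine (dmap_coord (f := f) _ _); solve [dm]
            | refine (dmap_fun (f := f) _ _); solve [dm]
            | refine (dmap_proj (f := f) _); solve [dm] ]
  end.

(** [ds] decomposes a definability goal along connectives and quantifiers; [ds_leaf] is a hook,
    redefined once there are atomic relations to recognise. *)
Ltac ds_leaf := fail.
Ltac ds_step :=
  cbv beta;
  lazymatch goal with
  | |- dset (fun z => @?A z /\ @?B z) => refine (dset_and (A := A) (A' := B) _ _)
  | |- dset (fun z => ~ @?A z) => refine (dset_not (A := A) _)
  | |- dset (fun z => exists x, @?A z x) => refine (dset_ex (A := A) _)
  | |- dset (fun z => @?A z -> @?B z) => refine (dset_imp (A := A) (A' := B) _ _)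
  | |- dset (fun z => forall x, @?A z x) => refine (dset_all (A := A) _)
  | |- dset (fun z => _ = _) => apply: dset_eqZ; dm
  | |- _ => first [ eassumption | ds_leaf | apply: dset_const ]
  end.
Ltac ds := repeat ds_step.

Section counting.
Context {L : language} {M : structure L}.

Lemma dset_many (Z Z' : dty M) N (S : Z -> Z' -> Prop) :
  dset (fun p : Z * Z' => S p.1 p.2) -> dset (fun z => many N (S z)).
Proof.
move=> dS; apply: (@dset_ex _ _ _ (dty_fun 'I_N Z')).
apply: dset_and.
  apply: dset_fin_all => i; apply: dset_fin_all => j.
  apply: dset_imp; last exact: dset_const.
  by apply: dset_eqZ; dm.
apply: dset_fin_all => i. refine (dset2 dS _ _); dm.
Qed.

End counting.

(** * A canonical topology definable without parameters *)

Section uniform_families.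
Context {L : language} (M : structure L).

(** Interior for the topology of [c], where [D c t] means that [t] codes an entourage [u c t]. The
    parameter [c] is kept as a variable. *)
Definition sint (C T : dty M) (D : C -> T -> Prop)
    (u : C -> T -> home_set M -> home_set M -> Prop) (c : C)
    (S : home_set M -> Prop) (y : home_set M) :=
  exists t, D c t /\ forall y', u c t y y' -> S y'.

(** A first-order condition on [c], so that it can be imposed on parameters other than the given
    one. *)
Definition is_unif (C T : dty M) (D : C -> T -> Prop)
    (u : C -> T -> home_set M -> home_set M -> Prop) (c : C) :=
  (exists t, D c t) /\
  (forall t y, D c t -> u c t y y) /\
  (forall t y y', D c t -> u c t y y' -> u c t y' y) /\
  (forall t t', D c t -> D c t' -> exists t'', D c t'' /\
     forall y y', u c t'' y y' -> u c t y y' /\ u c t' y y') /\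
  (forall t, D c t -> exists t', D c t' /\
     forall y y' y'', u c t' y y' -> u c t' y' y'' -> u c t y y'').

(* A uniform structure on the home sort, given as the member of parameter [uc]
   of a parameter-free definable family of families of binary relations. *)
Record unif_fam := UnifFam {
  uC : dty M;
  uT : dty M;
  uc : uC;
  uD : uC -> uT -> Prop;
  ur : uC -> uT -> home_set M -> home_set M -> Prop;
  uD_dset : dset (fun p : uC * uT => uD p.1 p.2);
  ur_dset : dset (fun p : uC * uT * home_set M * home_set M =>
                    ur p.1.1.1 p.1.1.2 p.1.2 p.2);
  uc_unif : is_unif uD ur uc;
  uc_infinite : forall t y, uD uc t -> infinite_set (ur uc t y);
  uc_interior : forall (Z : dty M) (R : Z -> home_set M -> Prop),
    dset (fun p : Z * home_set M => R p.1 p.2) ->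
    forall z, infinite_set (R z) -> exists y, sint uD ur uc (R z) y }.

End uniform_families.

Ltac ds_leaf ::=
  first [ refine (dset4 (ur_dset _) _ _ _ _); dm
        | refine (dset2 (uD_dset _) _ _); dm
        | refine (dset_many _ _) ].

(** * Comparing the topologies of two parameters *)

Section good_parameters.
Context {L : language} {M : structure L} (M_saturated : saturated M) (X : unif_fam M).

Local Notation HM := (home_set M).
Local Notation C := (uC X).
Local Notation T := (uT X).
Local Notation c0 := (uc X).
Local Notation D := (@uD _ _ X).
Local Notation u := (@ur _ _ X).
Local Notation int := (sint D u).

Lemma sintS c (S S' : HM -> Prop) y : (forall x, S x -> S' x) -> int c S y -> int c S' y.
Proof. by move=> sS [t [Dt h]]; exists t; split => // x /h /sS. Qed.

Lemma sint_mem c (S : HM -> Prop) y : is_unif D u c -> int c S y -> S y.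
Proof. by move=> [_ [r _]] [t [Dt h]]; apply: h; exact: r. Qed.

(** Otherwise saturation yields a single [z] whose fibre is infinite and has no interior, against
    [uc_interior]. *)
Lemma uniform_bound (Z : dty M) (R : Z -> HM -> Prop) :
  dset (fun p : Z * HM => R p.1 p.2) ->
  exists N, forall z, many N (R z) -> exists y, int c0 (R z) y.
Proof.
move=> dR; apply: contrapT => hN.
have {}hN N : exists z, many N (R z) /\ ~ exists y, int c0 (R z) y.
  apply: contrapT => h; apply: hN; exists N => z mz; apply: contrapT => ni.
  by apply: h; exists z.
pose A N c z := many N (R z) /\ ~ exists y, int c (R z) y.
have [||z hz] := @saturated_seq _ _ M_saturated C Z c0 A _ _ hN.
- by move=> n; rewrite /A /sint; ds; refine (dset2 dR _ _); dm.
- by move=> n z [mz ?]; split => //; apply: many_leq mz.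
- have [_ []] := hz 0%N; apply: (@uc_interior _ _ X _ _ dR).
  by apply: many_infinite => N; have [] := hz N.
Qed.

Lemma common_radius c n (t : 'I_n -> T) : is_unif D u c -> (forall i, D c (t i)) ->
  exists t', D c t' /\ forall i y y', u c t' y y' -> u c (t i) y y'.
Proof.
move=> [[s Ds] [_ [_ [hm _]]]]; elim: n t => [|n IH] t Dt; first by exists s; split => // -[].
have [t1 [D1 h1]] := IH (fun i => t (lift ord0 i)) (fun i => Dt _).
have [t' [D' h']] := hm _ _ D1 (Dt ord0).
exists t'; split => // i y y' /h'[u1 u0].
by case: (unliftP ord0 i) => [j|] ->; [exact: h1|].
Qed.

(** Inclusion of neighbourhood filters at the single point [y]; [eqv] below is equality of these
    germs. *)
Definition finer c c' y := forall t', D c' t' -> int c (u c' t' y) y.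

(* The instances of [uc_interior] and [uniform_bound] that are needed to compare
   the topologies of two parameters, written as a formula in [c]. *)
Definition good N0 N1 c :=
  is_unif D u c /\
  (forall t y, D c t -> many N1 (u c t y)) /\
  (forall c1 t1 y1, many N1 (u c1 t1 y1) -> exists y, int c (u c1 t1 y1) y) /\
  (forall c1 t1, many N0 (fun y => ~ int c1 (u c t1 y) y) ->
    exists y, int c (fun y => ~ int c1 (u c t1 y) y) y).

Lemma good_exists : exists N0 N1, good N0 N1 c0.
Proof.
have [|N0 h0] := @uniform_bound (C * C * T)%type
    (fun p y => ~ int p.1.2 (u p.1.1 p.2 y) y).
  by rewrite /sint; ds.
have [|N1 h1] := @uniform_bound (C * T * HM)%type (fun p y => u p.1.1 p.1.2 p.2 y).
  by ds.
exists N0, N1; split; first exact: uc_unif.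
split; last split.
- by move=> t y Dt; apply: infinite_many; exact: uc_infinite.
- by move=> c1 t1 y1; exact: (h1 (c1, t1, y1)).
- by move=> c1 t1; exact: (h0 (c0, c1, t1)).
Qed.

Lemma dset_good N0 N1 : dset (good N0 N1).
Proof.
rewrite /good /is_unif /sint; ds.
Qed.

(** One radius [t'] serves for [N0] exceptional points, so the points exceptional for [t'] fill a
    [c']-ball around some [x0]. A smaller [c']-ball has a [c]-interior point [x1]; as it lies in the
    [t']-ball of [x1], the point [x1] is not exceptional. *)
Lemma finer_bound N0 N1 c c' : good N0 N1 c -> good N0 N1 c' ->
  ~ many N0 (fun y => ~ finer c c' y).
Proof.
move=> [uc [_ [bc _]]] [uc' [ac' [_ dc']]] [g [ig hg]].
have /choice[t ht] : forall i, exists t, D c' t /\ ~ int c (u c' t (g i)) (g i).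
  by move=> i; have := hg i; move/existsNP => [t /not_implyP ?]; exists t.
have [t' [Dt' ut']] := common_radius uc' (fun i => (ht i).1).
have [|x0 [s [Ds hs]]] := dc' c t'.
  exists g; split => // i; move: (ht i).2; apply: contra_not.
  by apply: sintS => x; exact: ut'.
have [_ [r' [sy' [me' ha']]]] := uc'.
(* With half the radius, the [s']-ball of [x0] lies in the [t']-ball of each of its points. *)
have [w [Dw hw]] := ha' _ Dt'.
have [s' [Ds' hs']] := me' _ _ Ds Dw.
have [x1 ix1] := bc _ _ _ (ac' s' x0 Ds').
have us'x1 := sint_mem uc ix1.
have [us uw] := hs' _ _ us'x1.
apply: (hs _ us); apply: sintS ix1 => x /hs'[_ ux].
by apply: hw ux; exact: sy'.
Qed.

Definition eqv y c c' := finer c c' y /\ finer c' c y.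

Lemma finer_refl c y : finer c c y.
Proof. by move=> t Dt; exists t. Qed.

Lemma finer_trans c c' c'' y : finer c c' y -> finer c' c'' y -> finer c c'' y.
Proof. by move=> h h' t /h'[t' [Dt' ut']]; apply: sintS (h _ Dt') => x; exact: ut'. Qed.

Lemma eqv_sym y c c' : eqv y c c' -> eqv y c' c.
Proof. by move=> []; split. Qed.

Lemma eqv_trans y c c' c'' : eqv y c c' -> eqv y c' c'' -> eqv y c c''.
Proof. by move=> [a b] [a' b']; split; [exact: finer_trans a a'|exact: finer_trans b' b]. Qed.

Lemma eqv_bound N0 N1 c c' : good N0 N1 c -> good N0 N1 c' ->
  ~ many (N0 + N0) (fun y => ~ eqv y c c').
Proof.
move=> gc gc' h.
have /manyU[] : many (N0 + N0) ([set y | ~ finer c c' y] `|` [set y | ~ finer c' c y]).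
- by apply: many_sub h => y /not_andP.
- exact: finer_bound gc gc'.
- exact: finer_bound gc' gc.
Qed.

End good_parameters.

(** * Average disagreement of tuples *)

Section disagreement.
Local Open Scope nat_scope.
Context {T P : Type} (E : P -> T -> T -> Prop).
Hypothesis E_refl : forall y a, E y a a.
Hypothesis E_sym : forall y a b, E y a b -> E y b a.
Hypothesis E_trans : forall y a b c, E y a b -> E y b c -> E y a c.

Definition disagree (y : P) (a b : T) : nat := `[< ~ E y a b >].

(* The distance "different classes" is of negative type: with [A x] and [B x] the
   numbers of indices in the class [x], this is [0 <= \sum_x (A x - B x)^2]. *)
Lemma disagree_cross (I J : finType) (a : I -> T) (b : J -> T) y : #|I| = #|J| ->
  (\sum_i \sum_j disagree y (a i) (a j) + \sum_i \sum_j disagree y (b i) (b j)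
   <= 2 * \sum_i \sum_j disagree y (a i) (b j))%N.
Proof.
move=> eIJ.
(* Classes are encoded as predicates, [k x] being the class of [x], to get a boolean equality on
   them. *)
pose K := {classic (T -> Prop)}.
pose k (x : T) : K := E y x.
have ek x z : (k x == k z) = `[< E y x z >].
  apply/eqP/asboolP => [e|h]; first by rewrite -/(k x z) e; exact: E_refl.
  apply/funext => w; apply/propext; split; apply: E_trans => //; exact: E_sym.
pose s := undup ([seq k (a i) | i <- enum I] ++ [seq k (b j) | j <- enum J]).
(* A pair of indices either disagrees or lies in a common class; the sum over [s] counts the pairs
   of the second kind, class by class. *)
have split_eq (I' J' : finType) (a' : I' -> T) (b' : J' -> T) :
    (forall i, k (a' i) \in s) ->
    (\sum_i \sum_j disagree y (a' i) (b' j)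
     + \sum_(x <- s) (\sum_i (k (a' i) == x)) * (\sum_j (k (b' j) == x)) = #|I'| * #|J'|)%N.
  move=> as_.
  transitivity (\sum_i \sum_j (disagree y (a' i) (b' j) + (k (a' i) == k (b' j))))%N.
    rewrite [RHS](eq_bigr (fun i => \sum_j disagree y (a' i) (b' j) +
      \sum_j (k (a' i) == k (b' j)))%N); last by move=> i _; rewrite big_split.
    rewrite big_split /=; congr addn.
    transitivity (\sum_(x <- s) \sum_i \sum_j (k (a' i) == x) * (k (b' j) == x))%N.
      by apply: eq_bigr => x _; rewrite big_distrlr.
    rewrite exchange_big /=; apply: eq_bigr => i _.
    rewrite exchange_big /=; apply: eq_bigr => j _.
    rewrite (bigD1_seq (k (a' i))) ?undup_uniq ?as_ //= eqxx mul1n.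
    rewrite big1 ?addn0 1?eq_sym // => x; rewrite eq_sym => /negbTE ->.
    by rewrite mul0n.
  under eq_bigr => i _.
    under eq_bigr => j _.
      rewrite /disagree ek.
      rewrite (_ : _ + _ = 1)%N; last first.
        by rewrite asbool_neg; case: asboolP.
    over.
    rewrite sum1_card.
  over.
  by rewrite sum_nat_const.
have ha i : k (a i) \in s by rewrite mem_undup mem_cat map_f ?mem_enum.
have hb j : k (b j) \in s by rewrite mem_undup mem_cat orbC map_f ?mem_enum.
have eaa := split_eq _ _ a a ha; have ebb := split_eq _ _ b b hb.
have eab := split_eq _ _ a b ha.
set Saa := (\sum_(x <- s) _)%N in eaa; set Sbb := (\sum_(x <- s) _)%N in ebb.
set Sab := (\sum_(x <- s) _)%N in eab.
have le : (2 * Sab <= Saa + Sbb)%N.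
  rewrite /Sab /Saa /Sbb big_distrr -big_split /=; apply: leq_sum => x _.
  by rewrite !mulnn; exact: nat_Cauchy.
rewrite eIJ in eaa eab.
move: eaa ebb eab le; lia.
Qed.

Definition disagreement (I : finType) (a : I -> T) (Y : seq {classic P}) : nat :=
  \sum_(y <- Y) \sum_i \sum_j disagree y (a i) (a j).

Lemma disagreement_le (I : finType) (a : I -> T) (Y Y' : seq {classic P}) :
  uniq Y -> {subset Y <= Y'} -> (disagreement a Y <= disagreement a Y')%N.
Proof.
move=> uY sY; apply: (@leq_trans (disagreement a (undup Y'))); last first.
  rewrite /disagreement.
  elim: Y' {sY} => //= y Y' IH; case: ifP => _; rewrite ?big_cons.
    exact: leq_trans IH (leq_addl _ _).
  by rewrite leq_add2l.
rewrite /disagreement [X in (_ <= X)%N](perm_big (Y ++ [seq y <- undup Y' | y \notin Y])) /=.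
  by rewrite big_cat /= leq_addr.
apply: uniq_perm; first exact: undup_uniq.
  rewrite cat_uniq uY filter_uniq ?undup_uniq // andbT.
  by apply/hasPn => y; rewrite mem_filter => /andP[].
move=> y; rewrite mem_cat mem_filter mem_undup.
by case: (boolP (y \in Y)) => //= /sY.
Qed.

Definition join (I : Type) (a b : I -> T) (x : I + I) : T :=
  match x with inl i => a i | inr i => b i end.

Lemma sum_join (I : finType) (a b : I -> T) y :
  \sum_i \sum_j disagree y (join a b i) (join a b j) =
  (\sum_i \sum_j disagree y (a i) (a j) + \sum_i \sum_j disagree y (b i) (b j)
   + 2 * \sum_i \sum_j disagree y (a i) (b j))%N.
Proof.
rewrite big_sumType /=.
under eq_bigr => i _ do rewrite big_sumType /=.
under [X in (_ + X)%N]eq_bigr => i _ do rewrite big_sumType /=.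
rewrite !big_split /= mul2n -addnn.
have -> : \sum_i \sum_j disagree y (b i) (a j) = \sum_i \sum_j disagree y (a i) (b j).
  rewrite exchange_big; apply: eq_bigr => i _; apply: eq_bigr => j _.
  by rewrite /disagree; congr nat_of_bool; apply: asbool_equiv_eq; split;
     apply: contra_not; exact: E_sym.
lia.
Qed.

(** At [y] all cross pairs disagree, and each is counted twice, whence [2 * #|I| ^ 2]. At the other
    points [disagree_cross] makes the cross pairs contribute at least as much as the two tuples
    themselves. *)
Lemma disagreement_join (I : finType) (a b : I -> T) (Y Y' : seq {classic P}) y c d :
  uniq Y -> uniq Y' -> (forall i, E y (a i) c) -> (forall i, E y (b i) d) ->
  ~ E y c d ->
  exists Z : seq {classic P}, uniq Z /\
    (2 * disagreement a Y + 2 * disagreement b Y' + 2 * #|I| ^ 2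
     <= disagreement (join a b) Z)%N.
Proof.
move=> uY uY' ac bd ncd.
pose Z := undup ((y : {classic P}) :: Y ++ Y').
have uZ : uniq Z by exact: undup_uniq.
exists Z; split => //.
have leY : (disagreement a Y <= disagreement a Z)%N.
  by apply: disagreement_le => // x xY; rewrite mem_undup inE mem_cat xY orbT.
have leY' : (disagreement b Y' <= disagreement b Z)%N.
  by apply: disagreement_le => // x xY; rewrite mem_undup inE mem_cat xY !orbT.
suff : (2 * disagreement a Z + 2 * disagreement b Z + 2 * #|I| ^ 2
     <= disagreement (join a b) Z)%N by lia.
have yZ : (y : {classic P}) \in Z by rewrite mem_undup inE eqxx.
rewrite /disagreement !(bigD1_seq _ yZ uZ) /= sum_join.
have ea : \sum_i \sum_j disagree y (a i) (a j) = 0.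
  apply: big1 => i _; apply: big1 => j _; rewrite /disagree.
  suff h : E y (a i) (a j) by rewrite asboolF //; exact.
  by apply: E_trans (ac i) (E_sym (ac j)).
have eb : \sum_i \sum_j disagree y (b i) (b j) = 0.
  apply: big1 => i _; apply: big1 => j _; rewrite /disagree.
  suff h : E y (b i) (b j) by rewrite asboolF //; exact.
  by apply: E_trans (bd i) (E_sym (bd j)).
have eab : \sum_i \sum_j disagree y (a i) (b j) = #|I| ^ 2.
  rewrite (eq_bigr (fun=> \sum_(j in I) 1)) => [|i _]; last first.
    apply: eq_bigr => j _; rewrite /disagree asboolT // => h; apply: ncd.
    by apply: E_trans (E_sym (ac i)) _; apply: E_trans h (bd j).
  by rewrite sum1_card sum_nat_const mulnn.
pose FA x := \sum_i \sum_j disagree x (a i) (a j).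
pose FB x := \sum_i \sum_j disagree x (b i) (b j).
have hS : (2 * \sum_(x <- Z | x != y) FA x + 2 * \sum_(x <- Z | x != y) FB x <=
    \sum_(x <- Z | x != y) \sum_i \sum_j disagree x (join a b i) (join a b j))%N.
  rewrite -mulnDr -big_split /= big_distrr /=; apply: leq_sum => x _.
  rewrite sum_join -/(FA x) -/(FB x).
  by have := @disagree_cross I I a b x erefl; rewrite -/(FA x) -/(FB x); lia.
have aux p q r k : (2 * p + 2 * q <= r -> 2 * p + 2 * q + 2 * k <= 2 * k + r)%N by lia.
by rewrite ea eb eab !add0n; exact: aux hS.
Qed.

Variables (G : T -> Prop) (a0 : T) (n : nat).
Hypothesis G_a0 : G a0.
Hypothesis G_bound : forall a b, G a -> G b -> ~ many n (fun y => ~ E y a b).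

(** Summing over pairs of indices first: each pair disagrees at fewer than [n] points. *)
Lemma disagreement_bound (I : finType) (a : I -> T) (Y : seq {classic P}) :
  (forall i, G (a i)) -> uniq Y -> (disagreement a Y <= n * #|I| ^ 2)%N.
Proof.
move=> Ga uY; rewrite /disagreement exchange_big /=.
have -> : n * #|I| ^ 2 = \sum_(i : I) \sum_(j : I) n.
  by rewrite !sum_nat_const mulnA mulnn mulnC.
apply: leq_sum => i _; rewrite exchange_big /=; apply: leq_sum => j _.
rewrite leqNgt; apply/negP => lt; apply: (G_bound (Ga i) (Ga j)).
pose W : seq {classic P} := [seq y <- Y | `[< ~ E y (a i) (a j) >]].
have sW : size W = \sum_(y <- Y) disagree y (a i) (a j).
  rewrite size_filter -sum1_count big_mkcond /=; apply: eq_bigr => y _.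
  by rewrite /disagree; case: asboolP.
have uW : uniq W by rewrite filter_uniq.
apply: (@many_leq _ (size W)); first by rewrite sW ltnW.
exists (tnth (in_tuple W)); split; first by apply/(tuple_uniqP (in_tuple W)).
move=> k; have : tnth (in_tuple W) k \in W by exact: mem_tnth.
by rewrite mem_filter => /andP[/asboolP].
Qed.

(* Otherwise, doubling would increase the average disagreement
   [disagreement a Y / #|I| ^ 2] by [1 / 2] forever. *)
Lemma stable_tuple : exists (I : finType) (a : I -> T) (Y : seq {classic P}),
  [/\ (0 < #|I|)%N, forall i, G (a i), uniq Y &
   forall (b : I + I -> T) (Z : seq {classic P}), (forall i, G (b i)) -> uniq Z ->
     (disagreement b Z < 4 * disagreement a Y + 2 * #|I| ^ 2)%N].
Proof.
apply: contrapT => nex.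
have h s : exists (I : finType) (a : I -> T) (Y : seq {classic P}),
    [/\ (0 < #|I|)%N, forall i, G (a i), uniq Y &
        (s * #|I| ^ 2 <= 2 * disagreement a Y)%N].
  elim: s => [|s [I [a [Y [I0 Ga uY le]]]]].
    by exists unit, (fun=> a0), [::]; rewrite card_unit mul0n.
  have [b [Z [Gb uZ lt]]] : exists (b : I + I -> T) (Z : seq {classic P}),
      [/\ forall i, G (b i), uniq Z &
        (4 * disagreement a Y + 2 * #|I| ^ 2 <= disagreement b Z)%N].
    apply: contrapT => hb; apply: nex; exists I, a, Y; split => // b Z Gb uZ.
    by rewrite ltnNge; apply/negP => hl; apply: hb; exists b, Z.
  exists (I + I)%type, b, Z; split => //; first by rewrite card_sum addn_gt0 I0.
  rewrite card_sum addnn -mul2n expnMn.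
  have aux (x p q : nat) : (s * x <= 2 * p -> 4 * p + 2 * x <= q ->
      s.+1 * (2 ^ 2 * x) <= 2 * q)%N by rewrite (_ : 2 ^ 2 = 4)%N //; nia.
  exact: aux le lt.
(* The average would now be at least [n + 1 / 2], beyond its bound [n]. *)
have [I [a [Y [I0 Ga uY le]]]] := h (2 * n).+1.
have := disagreement_bound Ga uY.
have : (0 < #|I| ^ 2)%N by rewrite expn_gt0 I0.
have aux (x p : nat) : ((2 * n).+1 * x <= 2 * p -> 0 < x -> p <= n * x -> False)%N by nia.
exact: aux le.
Qed.

End disagreement.

(** * Neighbourhoods read off from unanimous tuples *)

Section canonical_topology.
Context {L : language} {M : structure L} (M_saturated : saturated M) (X : unif_fam M).

Local Notation HM := (home_set M).
Local Notation C := (uC X).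
Local Notation T := (uT X).
Local Notation c0 := (uc X).
Local Notation D := (@uD _ _ X).
Local Notation u := (@ur _ _ X).
Local Notation int := (sint D u).

(* [nu s y], for [sigma s y], is a basis of neighbourhoods of [y] for a topology
   that does not refer to the parameter [c0]. *)
Lemma canonical_nbhds : exists (S : dty M) (sigma : S -> HM -> Prop)
    (nu : S -> HM -> HM -> Prop) (N : nat),
  [/\ dset (fun p : S * HM => sigma p.1 p.2),
      dset (fun p : S * HM * HM => nu p.1.1 p.1.2 p.2),
      forall s s' y, sigma s y -> sigma s' y -> exists s'', sigma s'' y /\
        forall x, nu s'' y x -> nu s y x /\ nu s' y x,
      forall s y, sigma s y -> exists x, int c0 (nu s y) x &
      ~ many N (fun y => ~ forall A : HM -> Prop, int c0 A y ->
          exists s, sigma s y /\ forall x, nu s y x -> A x)].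
Proof.
have [N0 [N1 g0]] := good_exists M_saturated X.
have refl y (c : C) : eqv y c c by split; exact: (@finer_refl _ _ X).
have sym := fun y c c' => @eqv_sym _ _ X y c c'.
have trans := fun y c c' c'' => @eqv_trans _ _ X y c c' c''.
have [I [a [Y [I0 Ga uY stable]]]] := @stable_tuple C HM (@eqv _ _ X)
  (good N0 N1) c0 (N0 + N0) g0 (fun c c' gc gc' => eqv_bound gc gc').
pose r := size Y.
pose y_ (k : 'I_r) : HM := tnth (in_tuple Y) k.
(* The tuple [b] shows, at some [r] distinct points, all the disagreements that [a] shows on [Y]. *)
pose pat (b : I -> C) := (forall i, good N0 N1 (b i)) /\
  exists Z : 'I_r -> HM, injective Z /\
    forall k i j, ~ eqv (y_ k) (a i) (a j) -> ~ eqv (Z k) (b i) (b j).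
(* Some tuple with this pattern is unanimous at [y], on the germ of [c]. *)
pose maj y c := good N0 N1 c /\ exists b : dty_fun I C, pat b /\ forall i, eqv y (b i) c.
have pata : pat a.
  split => //; exists y_; split => // i j e; apply/val_inj.
  by have /(tuple_uniqP (in_tuple Y)) h : uniq Y by []; have /(congr1 val) := h _ _ e.
have pat_le b : pat b -> exists Z : seq {classic HM}, uniq Z /\
    (disagreement (@eqv _ _ X) a Y <= disagreement (@eqv _ _ X) b Z)%N.
  move=> [Gb [Z [iZ hZ]]].
  exists [seq (Z k : {classic HM}) | k <- enum 'I_r]; split.
    by rewrite map_inj_uniq ?enum_uniq.
  rewrite /disagreement big_map big_enum /=.
  rewrite (big_tnth _ _ Y) /=; apply: leq_sum => k _.
  apply: leq_sum => i _; apply: leq_sum => j _; rewrite /disagree.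
  by case: asboolP => // /(hZ k i j) h; rewrite asboolT.
(* Two tuples unanimous on different germs at [y] would join to one whose disagreement contradicts
   the stability of [a]. *)
have maj_eqv y c c' : maj y c -> maj y c' -> eqv y c c'.
  move=> [_ [b [pb bc]]] [_ [b' [pb' bc']]]; apply: contrapT => ncc'.
  have [Z [uZ leZ]] := pat_le b pb; have [Z' [uZ' leZ']] := pat_le b' pb'.
  have [W [uW leW]] := disagreement_join refl sym trans uZ uZ' bc bc' ncc'.
  have /(stable _ W)/(_ uW) : forall i, good N0 N1 (join b b' i).
    by case=> i; [exact: pb.1|exact: pb'.1].
  by move: leZ leZ' leW; lia.
have dmaj : dset (fun p : HM * C => maj p.1 p.2).
  have dg := dset_good X N0 N1.
  have de : dset (fun p : HM * C * C => eqv p.1.1 p.1.2 p.2).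
    by rewrite /eqv /finer /sint; ds.
  rewrite /maj /pat; apply: dset_and; first by refine (dset1 dg _); dm.
  apply: dset_ex; apply: dset_and; last first.
    by apply: dset_fin_all => i; refine (dset3 de _ _ _); dm.
  apply: dset_and.
    by apply: dset_fin_all => i; refine (dset1 dg _); dm.
  apply: (@dset_ex _ _ _ (dty_fun 'I_r HM)); apply: dset_and.
    apply: dset_fin_all => i; apply: dset_fin_all => j.
    by apply: dset_imp; [apply: dset_eqZ; dm|exact: dset_const].
  apply: dset_fin_all => k; apply: dset_fin_all => i; apply: dset_fin_all => j.
  (* The pattern of [a] enters only through truth values, so [maj] needs no parameters. *)
  apply: dset_imp; first exact: dset_const.
  by apply: dset_not; refine (dset3 de _ _ _); dm.
(* Off this finite set, [a] itself is unanimous on the germ of [c0]. *)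
have fin : finite_set (fun y : HM => exists i, ~ eqv y (a i) c0).
  apply: (@sub_finite_set _ _ (\bigcup_(i in [set: I]) (fun y => ~ eqv y (a i) c0))).
    by move=> y [i h]; exists i.
  apply: bigcup_finite => [|i _]; first exact: finite_finset.
  by apply/finite_notmany; exists (N0 + N0)%N; exact: eqv_bound (Ga i) g0.
have [N hN] := (finite_notmany _).1 fin.
exists (C * T)%type, (fun s y => maj y s.1 /\ D s.1 s.2), (fun s y x => u s.1 s.2 y x), N.
split.
- apply: dset_and; first by refine (dset2 dmaj _ _); dm.
  by ds.
- by ds.
- move=> [c t] [c' t'] y /= [mc Dt] [mc' Dt'].
  have [h _] := maj_eqv _ _ _ mc mc'; have [t2 [Dt2 ht2]] := h _ Dt'.
  have [[_ [_ [_ [meet _]]]] _] := mc.1.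
  have [t3 [Dt3 ht3]] := meet _ _ Dt Dt2.
  by exists (c, t3) => /=; split => // x /ht3[? /ht2].
- move=> [c t] y /= [[[_ [gc _]] _] Dt].
  by have [_ [_ [h _]]] := g0; exact: h (gc _ _ Dt).
- apply: contra_not hN; apply: many_sub => y; apply: contra_notP => hy A [t [Dt ht]].
  exists (c0, t); split => //=; split => //; split => //.
  exists a; split => // i; apply: contrapT => h; apply: hy; by exists i.
Qed.

End canonical_topology.

(** * Thin sets *)

Section grids.
Context {L : language} {M : structure L}.
Local Notation HM := (home_set M).

Definition grid n m (S : 'I_n -> 'I_m -> HM) (A : pow M n -> Prop) :=
  (forall i, injective (S i)) /\ forall e : 'I_n -> 'I_m, A (fun i => S i (e i)).

(* Double counting: [E i] contains at most [N * m ^ n / m] of the [m ^ n] points. *)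
Lemma grid_thin n m N (S : 'I_n -> 'I_m -> HM) (E : 'I_n -> pow M n -> Prop) :
  (forall i x, ~ many N (fun y => E i (upd x i y))) ->
  grid S (fun x => exists i, E i x) -> (m <= n * N)%N.
Proof.
move=> thin [iS hS].
have [->//|m0] := posnP m.
pose pt (e : {ffun 'I_n -> 'I_m}) : pow M n := fun i => S i (e i).
pose F i e : nat := `[< E i (pt e) >].
pose up i (e : {ffun 'I_n -> 'I_m}) a : {ffun 'I_n -> 'I_m} :=
  [ffun j => if j == i then a else e j].
have upE i e a : pt (up i e a) = upd (pt e) i (S i a).
  by apply/pow_ext => j; rewrite /pt /upd ffunE; case: eqP => // ->.
have F_sum i : (m * \sum_e F i e = \sum_e \sum_a F i (up i e a))%N.
  rewrite pair_big /=.
  (* Exchanging coordinate [i] of [e] with the spare value [a] is an involution; hence the sum over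
     all lines counts each point [m] times. *)
  pose phi (p : {ffun 'I_n -> 'I_m} * 'I_m) := (up i p.1 p.2, p.1 i).
  have phiK : involutive phi.
    move=> [e a]; rewrite /phi /= ffunE eqxx; congr pair.
    by apply/ffunP => j; rewrite !ffunE; case: eqP => // ->.
  transitivity (\sum_p F i (phi p).1)%N; last by [].
  rewrite -(reindex_inj (P := xpredT) (F := fun p => F i p.1) (inv_inj phiK)) /=.
  rewrite -(pair_big xpredT xpredT (fun e _ => F i e)) /= big_distrr /=.
  by apply: eq_bigr => e _; rewrite sum_nat_const card_ord.
have F_le i e : (\sum_a F i (up i e a) <= N)%N.
  rewrite leqNgt; apply/negP => lt; apply: (thin i (pt e)).
  apply: (@many_card _ _ [set a | `[< E i (pt (up i e a)) >]]%SET (S i)) => //.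
    by move=> a; rewrite inE upE => /asboolP.
  apply: leq_trans (ltnW lt) _; rewrite -sum1_card [leqRHS]big_mkcond /=.
  by apply: leq_sum => a _; rewrite inE /F; case: asboolP.
have card_e : (\sum_(e : {ffun 'I_n -> 'I_m}) 1 = m ^ n)%N.
  by rewrite sum1_card card_ffun !card_ord.
have mn0 : (0 < m ^ n)%N by rewrite expn_gt0 m0.
rewrite -(leq_pmul2r mn0) -mulnA.
apply: (@leq_trans (m * \sum_i \sum_e F i e)).
  rewrite leq_mul2l; apply/orP; right; rewrite -card_e exchange_big /=.
  apply: leq_sum => e _; have [i Ei] := hS e.
  by rewrite (bigD1 i) //= /F asboolT.
rewrite big_distrr /= -[X in (X * _)%N]card_ord -sum_nat_const; apply: leq_sum => i _.
rewrite F_sum; apply: (@leq_trans (\sum_(e : {ffun 'I_n -> 'I_m}) N)%N).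
  by apply: leq_sum => e _.
by rewrite sum_nat_const card_ffun !card_ord mulnC.
Qed.

End grids.

(** * Covers of sets without interior *)

Section thin_sets.
Context {L : language} {M : structure L} (M_saturated : saturated M) (X : unif_fam M).

Local Notation HM := (home_set M).
Local Notation C := (uC X).
Local Notation T := (uT X).
Local Notation c0 := (uc X).
Local Notation D := (@uD _ _ X).
Local Notation u := (@ur _ _ X).
Local Notation int := (sint D u).

Definition hasint n (A : pow M n -> Prop) :=
  exists x t, D c0 t /\ forall x', (forall i, u c0 t (x i) (x' i)) -> A x'.

Lemma hasintS n (A A' : pow M n -> Prop) : (forall x, A x -> A' x) -> hasint A -> hasint A'.
Proof. by move=> sA [x [t [Dt h]]]; exists x, t; split => // x' /h /sA. Qed.

Lemma hasint_grid n (A : pow M n -> Prop) m : hasint A ->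
  exists S : 'I_n -> 'I_m -> HM, grid S A.
Proof.
move=> [x [t [Dt h]]].
have /choice[S hS] i : exists g : 'I_m -> HM, injective g /\ forall a, u c0 t (x i) (g a).
  by have [g ?] := infinite_many m (@uc_infinite _ _ X t (x i) Dt); exists g.
exists S; split => [i|e]; first by have [] := hS i.
by apply: h => i; have [_] := hS i; apply.
Qed.

(** [E] and [N] serve all [z] at once, and [E] is definable with no parameter besides [z], although
    [hasint] refers to [c0]. *)
Definition has_thin_cover n := forall (Z : dty M) (A : Z -> pow M n -> Prop),
  dset (fun p : Z * pow M n => A p.1 p.2) ->
  exists (E : 'I_n -> Z -> pow M n -> Prop) (N : nat),
    [/\ forall i, dset (fun p : Z * pow M n => E i p.1 p.2),
        forall i z x, ~ many N (fun y => E i z (upd x i y)) &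
        forall z, ~ hasint (A z) -> forall x, A z x -> exists i, E i z x].

(** By double counting, thin sets cannot cover a grid of side [n * N + 1]; so each family has a grid
    size that forces interior in all its members. *)
Lemma thin_cover_grid n : has_thin_cover n ->
  forall (Z : dty M) (A : Z -> pow M n -> Prop),
    dset (fun p : Z * pow M n => A p.1 p.2) ->
    exists m, (0 < m)%N /\ forall z (S : 'I_n -> 'I_m -> HM), grid S (A z) -> hasint (A z).
Proof.
move=> H Z A dA; have [E [N [_ thin cov]]] := H Z A dA.
exists (n * N).+1; split => // z S [iS hS]; apply: contrapT => ni.
have : ((n * N).+1 <= n * N)%N; last by rewrite ltnn.
apply: (@grid_thin _ _ n _ N S (fun i => E i z)); first by move=> i; exact: thin.
by split => // e; apply: cov.
Qed.

Lemma thin_cover n : has_thin_cover n.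
Proof.
elim: n => [|n IH] Z A dA.
  (* A nonempty subset of the one-point power has interior, so there is nothing to cover. *)
  exists (fun _ _ _ => False), 0%N; split => [i|[]//|z ni x Ax]; first by case: i.
  case: ni; have [[t Dt] _] := uc_unif X; exists x, t; split => // x' _.
  suff -> : x' = x by [].
  by apply/pow_ext => -[].
have [S [sigma [nu [N0 [dsigma dnu meet nu_int sigma_near]]]]] :=
  canonical_nbhds M_saturated X.
(* [Q0] fixes a basic neighbourhood [s] of [y]; [Q] is the union over all [s], directed by
   [meet]. *)
pose Q0 (w : Z * S * HM) x' := forall y', nu w.1.2 w.2 y' -> A w.1.1 (fcons y' x').
have dQ0 : dset (fun p : (Z * S * HM) * pow M n => Q0 p.1 p.2).
  rewrite /Q0; ds; first by refine (dset3 dnu _ _ _); dm.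
  by refine (dset2 dA _ _); dm.
pose Q (w : Z * HM) x' := exists s, sigma s w.2 /\ Q0 (w.1, s, w.2) x'.
have dQ : dset (fun p : (Z * HM) * pow M n => Q p.1 p.2).
  rewrite /Q; ds; first by refine (dset2 dsigma _ _); dm.
  by refine (dset2 dQ0 _ _); dm.
have [m [m0 hm]] := thin_cover_grid IH dQ0.
have [E'' [N'' [dE'' thin'' cov'']]] := IH _ _ dQ.
(* [R] serves to bound [E0] on lines but does not enter its definition, which avoids [c0] by using
   [nu]. *)
pose R (w : Z * pow M n.+1 * C) y := A w.1.1 (upd w.1.2 ord0 y) /\
  ~ int w.2 (fun y' => A w.1.1 (upd w.1.2 ord0 y')) y.
have dR : dset (fun p : (Z * pow M n.+1 * C) * HM => R p.1 p.2).
  rewrite /R /sint; ds; first by refine (dset2 dA _ _); dm.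
  by refine (dset2 dA _ _); dm.
have [N1 hN1] := uniform_bound M_saturated X dR.
(* A set of non-interior points cannot have an interior point. *)
have thinR z x : ~ many N1 (R (z, x, c0)).
  move=> /hN1[y iy]; have [_] := sint_mem (uc_unif X) iy; apply.
  by apply: sintS iy => y' [].
pose E0 z (x : pow M n.+1) := A z x /\
  ~ exists s, sigma s (x ord0) /\ forall y', nu s (x ord0) y' -> A z (upd x ord0 y').
pose E i (z : Z) (x : pow M n.+1) := match unlift ord0 i with
  | Some j => E'' j (z, x ord0) (tail x) | None => E0 z x end.
(* In direction 0, [N1] bounds the points that are not interior for [c0], and [N0] those where [nu]
   misses a neighbourhood for [c0]. *)
exists E, (maxn N'' (N1 + N0)); split.
- move=> i; rewrite /E; case: (unlift ord0 i) => [j|].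
    by refine (dset2 (dE'' j) _ _); dm; match goal with |- ?G => idtac G end.
  rewrite /E0; ds.
  - by refine (dset2 dsigma _ _); dm.
  - by refine (dset3 dnu _ _ _); dm.
  - by refine (dset2 dA _ _); dm.
- move=> i z x; rewrite /E; case: (unliftP ord0 i) => [j|] ->.
    apply: contra_not (thin'' j (z, x ord0) (tail x)) => /(many_leq (leq_maxl _ _)).
    by apply: many_sub => y; rewrite tail_updS.
  move=> /(many_leq (leq_maxr _ _)) h.
  have [] : many N1 (R (z, x, c0)) \/ many N0 (fun y =>
      ~ (forall A : HM -> Prop, int c0 A y ->
            exists s, sigma s y /\ forall x, nu s y x -> A x)).
  + apply: manyU; apply: many_sub h => y; rewrite /E0 upd_same => -[Ay ny].
    have [near|] := pselect (forall A : HM -> Prop, int c0 A y ->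
            exists s, sigma s y /\ forall x, nu s y x -> A x); last by right.
    left; split => // iy; apply: ny; have [s [ss hs]] := near _ iy.
    by exists s; split => // y' /hs; rewrite upd_upd.
  + exact: thinR.
  + exact: sigma_near.
- move=> z ni x Ax.
  have [E0x|nE0] := pselect (E0 z x); first by exists ord0; rewrite /E unlift_none.
  have Qx : Q (z, x ord0) (tail x).
    apply: contrapT => nQ; apply: nE0; split => // -[s [ss hs]].
    by apply: nQ; exists s; split => // y' /hs; rewrite fcons_tail.
  suff nQ : ~ hasint (Q (z, x ord0)).
    by have [j Ej] := cov'' _ nQ _ Qx; exists (lift ord0 j); rewrite /E liftK.
  (* Interior in [Q] gives an [m]-grid. One [s] below all the [s_ e] puts this grid into [Q0], which
     therefore has interior; its product with the interior of [nu s y] gives a box in [A z]. *)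
  move=> /(hasint_grid m)[G [iG hG]]; set y := x ord0 in hG.
  have /choice[s_ hs] (e : {ffun 'I_n -> 'I_m}) :
      exists s, sigma s y /\ Q0 (z, s, y) (fun i => G i (e i)) by exact: hG.
  have [s [ss hle]] : exists s, sigma s y /\
      forall e, e \in enum {ffun 'I_n -> 'I_m} -> forall v, nu s y v -> nu (s_ e) y v.
    elim: (enum _) => [|e l [s [ss hle]]].
      (* Positivity of [m] supplies a grid point to start from. *)
      by exists (s_ [ffun=> Ordinal m0]); split => //; have [] := hs [ffun=> Ordinal m0].
    have [s' [ss' hs']] := meet _ _ _ ss (hs e).1.
    exists s'; split => // e'; rewrite inE => /predU1P[->|/hle le] v /hs'[] //.
    by move=> /le.
  have [|x1 [t [Dt ht]]] := hm (z, s, y) G.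
    split => // e v /= /(hle [ffun i => e i]); rewrite mem_enum => /(_ isT).
    have [_ q] := hs [ffun i => e i]; move=> /q /=.
    by congr (A z (fcons v _)); apply/pow_ext => i; rewrite ffunE.
  have [y1 [t1 [Dt1 ht1]]] := nu_int _ _ ss.
  have [_ [_ [_ [um _]]]] := uc_unif X.
  have [t2 [Dt2 ht2]] := um _ _ Dt Dt1.
  apply: ni; exists (fcons y1 x1), t2; split => // x' hx'.
  rewrite -(upd_id x' ord0) -fcons_tail; apply: ht.
    move=> i; have := hx' (lift ord0 i); rewrite fconsS.
    by move=> /ht2[].
  by apply: ht1; have := hx' ord0; rewrite fcons0 => /ht2[].
Qed.

End thin_sets.

(** * The ideal of sets without interior *)

Section interior_ideal.
Context {L : language} {M : structure L} (M_saturated : saturated M) (X : unif_fam M).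

Local Notation HM := (home_set M).
Local Notation c0 := (uc X).
Local Notation D := (@uD _ _ X).
Local Notation u := (@ur _ _ X).
Local Notation int := (sint D u).
Local Notation hasint := (hasint X).

(** If neither set had interior, their thin covers together would cover a grid larger than
    [grid_thin] allows. *)
Lemma hasintU n (Z1 Z2 : dty M) (A1 : Z1 -> pow M n -> Prop) (A2 : Z2 -> pow M n -> Prop) z1 z2 :
  dset (fun p : Z1 * pow M n => A1 p.1 p.2) ->
  dset (fun p : Z2 * pow M n => A2 p.1 p.2) ->
  hasint (fun x => A1 z1 x \/ A2 z2 x) -> hasint (A1 z1) \/ hasint (A2 z2).
Proof.
move=> dA1 dA2 hU; apply: contrapT => /not_orP[n1 n2].
have [E1 [N1 [_ thin1 cov1]]] := thin_cover M_saturated X dA1.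
have [E2 [N2 [_ thin2 cov2]]] := thin_cover M_saturated X dA2.
have [G [iG hG]] := hasint_grid (n * (N1 + N2)).+1 hU.
have : ((n * (N1 + N2)).+1 <= n * (N1 + N2))%N; last by rewrite ltnn.
apply: (@grid_thin _ _ n _ (N1 + N2) G (fun i x => E1 i z1 x \/ E2 i z2 x)).
  move=> i x h.
  by have /manyU[] : many (N1 + N2) ((fun y => E1 i z1 (upd x i y)) `|`
    (fun y => E2 i z2 (upd x i y))) by []; [exact: thin1|exact: thin2].
split => // e; have [A1e|A2e] := hG e.
- by have [i Ei] := cov1 _ n1 _ A1e; exists i; left.
- by have [i Ei] := cov2 _ n2 _ A2e; exists i; right.
Qed.

(** The union contains a grid of the size [m] that forces interior in any member of the family, and
    by directedness its finitely many points lie in one member. *)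
Lemma hasint_directed n (Z : dty M) (A : Z -> pow M n -> Prop) (I : Z -> Prop) :
  dset (fun p : Z * pow M n => A p.1 p.2) ->
  (forall z z', I z -> I z' -> exists z'', I z'' /\ forall x, A z x \/ A z' x -> A z'' x) ->
  hasint (fun x => exists z, I z /\ A z x) -> exists z, I z /\ hasint (A z).
Proof.
move=> dA dir /[dup] [[x0 [t0 [Dt0 ht0]]]] hI.
have [m [m0 hm]] := thin_cover_grid (@thin_cover _ _ M_saturated X n) dA.
have [G [iG hG]] := hasint_grid m hI.
have /choice[z_ hz] (e : {ffun 'I_n -> 'I_m}) :
  exists z, I z /\ A z (fun i => G i (e i)) by exact: hG.
have [z [Iz hle]] : exists z, I z /\
    forall e, e \in enum {ffun 'I_n -> 'I_m} -> forall x, A (z_ e) x -> A z x.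
  elim: (enum _) => [|e l [z [Iz hle]]].
    by exists (z_ [ffun=> Ordinal m0]); split => //; have [] := hz [ffun=> Ordinal m0].
  have [z' [Iz' hz']] := dir _ _ Iz (hz e).1.
  exists z'; split => // e'; rewrite inE => /predU1P[->|/hle le] x Ax; apply: hz'.
    by right.
  by left; exact: le.
exists z; split => //; apply: (hm z G); split => // e.
apply: (hle [ffun i => e i]); first by rewrite mem_enum.
have [_] := hz [ffun i => e i].
by congr (A _ _); apply/pow_ext => i; rewrite ffunE.
Qed.

End interior_ideal.

(** * Generic continuity *)

Section generic_continuity.
Context {L : language} {M : structure L} (M_saturated : saturated M) (X : unif_fam M).

Local Notation HM := (home_set M).
Local Notation C := (uC X).
Local Notation T := (uT X).
Local Notation c0 := (uc X).
Local Notation D := (@uD _ _ X).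
Local Notation u := (@ur _ _ X).
Local Notation int := (sint D u).
Local Notation hasint := (hasint X).

Definition nearby n c t (x y : pow M n) := forall i, u c t (x i) (y i).

Definition csets n c t (S S' : pow M n -> Prop) :=
  (forall y, S y -> exists y', S' y' /\ nearby c t y y') /\
  (forall y', S' y' -> exists y, S y /\ nearby c t y y').

Lemma dset_near (Z : dty M) n (c : Z -> C) (t : Z -> T) (x y : Z -> pow M n) :
  dmap c -> dmap t -> dmap x -> dmap y -> dset (fun z => nearby (c z) (t z) (x z) (y z)).
Proof. by move=> dc dt dx dy; apply: dset_fin_all => i; ds. Qed.

Lemma dset_csets (Z : dty M) n (c : Z -> C) (t : Z -> T) (S S' : Z -> pow M n -> Prop) :
  dmap c -> dmap t ->
  dset (fun p : Z * pow M n => S p.1 p.2) -> dset (fun p : Z * pow M n => S' p.1 p.2) ->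
  dset (fun z => csets (c z) (t z) (S z) (S' z)).
Proof.
move=> dc dt dS dS'; rewrite /csets.
have dct (Z' : dty M) (f : Z' -> Z) : dmap f -> dmap (fun z => c (f z)).
  by move=> df; exact: dmap_comp df dc.
have dtt (Z' : dty M) (f : Z' -> Z) : dmap f -> dmap (fun z => t (f z)).
  by move=> df; exact: dmap_comp df dt.
by apply: dset_and; ds; first [by refine (dset2 dS _ _); dm|by refine (dset2 dS' _ _); dm
  |by apply: dset_near; [refine (dct _ (fun z => z.1.1) _)
                        |refine (dtt _ (fun z => z.1.1) _)| |]; dm].
Qed.

Lemma near_refl n t (x : pow M n) : D c0 t -> nearby c0 t x x.
Proof. by move=> Dt i; have [_ [r _]] := uc_unif X; exact: r. Qed.

Lemma near_sym n t (x y : pow M n) : D c0 t -> nearby c0 t x y -> nearby c0 t y x.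
Proof. by move=> Dt h i; have [_ [_ [s _]]] := uc_unif X; exact: s. Qed.

Lemma near_meet t t' : D c0 t -> D c0 t' -> exists t'', D c0 t'' /\
  forall n (x y : pow M n), nearby c0 t'' x y -> nearby c0 t x y /\ nearby c0 t' x y.
Proof.
have [_ [_ [_ [m _]]]] := uc_unif X; move=> /m h /h[t'' [Dt'' ht'']].
by exists t''; split => // n x y xy; split => i; have [] := ht'' _ _ (xy i).
Qed.

Lemma near_half t : D c0 t -> exists t', D c0 t' /\
  forall n (x y z : pow M n), nearby c0 t' x y -> nearby c0 t' y z -> nearby c0 t x z.
Proof.
have [_ [_ [_ [_ h]]]] := uc_unif X; move=> /h[t' [Dt' ht']].
by exists t'; split => // n x y z xy yz i; exact: ht' (xy i) (yz i).
Qed.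

Lemma csets_sym n t (S S' : pow M n -> Prop) : D c0 t -> csets c0 t S S' -> csets c0 t S' S.
Proof.
move=> Dt [h h']; split => y.
- by move=> /h'[y' [? ?]]; exists y'; split => //; exact: near_sym.
- by move=> /h[y' [? ?]]; exists y'; split => //; exact: near_sym.
Qed.

Lemma csets_refl n t (S : pow M n -> Prop) : D c0 t -> csets c0 t S S.
Proof. by move=> Dt; split => y Sy; exists y; split => //; exact: near_refl. Qed.

Lemma csets_third t : D c0 t -> exists t', D c0 t' /\
  forall n (S1 S2 S3 S4 : pow M n -> Prop), csets c0 t' S1 S2 -> csets c0 t' S2 S3 ->
    csets c0 t' S3 S4 -> csets c0 t S1 S4.
Proof.
move=> /near_half[t1 [Dt1 ht1]]; have [t' [Dt' ht']] := near_half Dt1.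
exists t'; split => // n S1 S2 S3 S4 [a b] [c d] [e f]; split => y.
- move=> /a[y2 [S2y2 h2]]; have [y3 [S3y3 h3]] := c _ S2y2; have [y4 [S4y4 h4]] := e _ S3y3.
  exists y4; split => //; apply: ht1 (ht' _ _ _ _ h2 h3) _.
  exact: ht' h4 (near_refl _ Dt').
- move=> /f[y3 [S3y3 h3]]; have [y2 [S2y2 h2]] := d _ S3y3; have [y1 [S1y1 h1]] := b _ S2y2.
  exists y1; split => //; apply: ht1 (ht' _ _ _ _ h1 h2) _.
  exact: ht' h3 (near_refl _ Dt').
Qed.

(* The value [v] is found one coordinate at a time. If the values of a coordinate
   form an infinite set, this set contains a ball, and finitely many [x] give only
   finitely many values. *)
Lemma near_value l (Z : dty M) (W : Z -> HM -> Prop) (f : Z -> HM -> pow M l -> Prop) z t :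
  dset (fun p : Z * HM => W p.1 p.2) ->
  dset (fun p : Z * HM * pow M l => f p.1.1 p.1.2 p.2) ->
  D c0 t -> infinite_set (W z) ->
  (forall x, W z x -> finite_set (f z x) /\ exists y, f z x y) ->
  exists v, infinite_set (fun x => W z x /\ exists y, f z x y /\ nearby c0 t v y).
Proof.
move=> dW df Dt iW fW.
have [a0] := carrier_inhabited M (home L).
pose nearj j c t (v y : pow M l) := forall i : 'I_l, (i < j)%N -> u c t (v i) (y i).
suff /(_ l (leqnn l))[v hv] : forall j, (j <= l)%N -> exists v,
    infinite_set (fun x => W z x /\ exists y, f z x y /\ nearj j c0 t v y).
  exists v; apply: sub_infinite_set hv => x [Wx [y [fy ny]]]; split => //.
  by exists y; split => // i; exact: ny.
elim=> [_|j IH lj].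
  exists (fun=> a0); apply: sub_infinite_set iW => x Wx; split => //.
  by have [_ [y fy]] := fW _ Wx; exists y; split.
have [v hv] := IH (ltnW lj).
pose J := Ordinal lj.
have upd_near a y : nearj j c0 t v y -> u c0 t a (y J) -> nearj j.+1 c0 t (upd v J a) y.
  move=> ny na i; rewrite ltnS leq_eqVlt => /predU1P[ij|ij].
    have -> : i = J by exact: val_inj.
    by rewrite upd_same.
  rewrite /upd; case: eqP => [eij|_]; last exact: ny.
  by move: ij; rewrite eij ltnn.
pose S (w : Z * C * T * pow M l) a := exists x, W w.1.1.1 x /\
  exists y, f w.1.1.1 x y /\ nearj j w.1.1.2 w.1.2 w.2 y /\ y J = a.
have dS : dset (fun p : (Z * C * T * pow M l) * HM => S p.1 p.2).
  rewrite /S; ds; first by refine (dset2 dW _ _); dm.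
    by refine (dset3 df _ _ _); dm.
  by apply: dset_fin_all => i; ds.
pose w := (z, c0, t, v).
have [finS|infS] := pselect (finite_set (S w)).
  have [a ha] : exists a, infinite_set (fun x => W z x /\ exists y, f z x y /\
      nearj j c0 t v y /\ y J = a).
    apply: contrapT => na; apply: hv.
    apply: (@sub_finite_set _ _ (\bigcup_(a in S w) (fun x => W z x /\ exists y, f z x y /\
      nearj j c0 t v y /\ y J = a))).
      by move=> x [Wx [y [fy ny]]]; exists (y J) => //; [exists x|]; split => //; exists y.
    by apply: bigcup_finite => // a _; apply: contrapT => h; apply: na; exists a.
  exists (upd v J a); apply: sub_infinite_set ha => x [Wx [y [fy [ny ya]]]].
  split => //; exists y; split => //; apply: upd_near => //; rewrite ya.
  by have [_ [r _]] := uc_unif X; exact: r.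
have [a [s [Ds hs]]] := @uc_interior _ _ X _ _ dS w infS.
have [_ [_ [_ [um _]]]] := uc_unif X.
have [s' [Ds' hs']] := um _ _ Ds Dt.
exists (upd v J a) => fin.
apply: (@uc_infinite _ _ X s' a Ds').
apply: (@sub_finite_set _ _ (\bigcup_(x in (fun x => W z x /\ exists y, f z x y /\
    nearj j.+1 c0 t (upd v J a) y)) [set y J | y in f z x])).
  move=> b /hs'[/hs[x [Wx [y [fy [ny yb]]]]] tb].
  exists x; last by exists y.
  by split => //; exists y; split => //; apply: upd_near; rewrite ?yb.
apply: bigcup_finite => // x [Wx _]; apply: finite_image.
by have [] := fW _ Wx.
Qed.

Lemma many_add1 (U : Type) n (S S' : set U) x :
  S x -> ~ S' x -> S' `<=` S -> many n S' -> many n.+1 S.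
Proof.
move=> Sx nSx sS [g [ig hg]].
exists (fun i => if unlift ord0 i is Some j then g j else x); split.
  move=> i j; case: (unliftP ord0 i) => [i'|] ->; case: (unliftP ord0 j) => [j'|] -> //.
  - by move=> /ig ->.
  - by move=> e; case: nSx; rewrite -e.
  - by move=> e; case: nSx; rewrite e.
by move=> i; case: (unlift ord0 i) => [j|] //; apply: sS.
Qed.

(** Induction on the bound for the number of values: [near_value] gives a [v] near some value at
    infinitely many points; [v] joins [Ys] and the values near it are discarded. The parameter type
    changes because [W] and [f] are cut down using [t] and [v]. *)
Lemma constant_infinite l n (Z : dty M) (W : Z -> HM -> Prop)
    (f : Z -> HM -> pow M l -> Prop) z t :
  dset (fun p : Z * HM => W p.1 p.2) ->
  dset (fun p : Z * HM * pow M l => f p.1.1 p.1.2 p.2) ->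
  D c0 t -> infinite_set (W z) -> (forall x, W z x -> ~ many n (f z x)) ->
  exists (Z' : dty M) (W' : Z' -> HM -> Prop) z' (Ys : pow M l -> Prop),
    [/\ dset (fun p : Z' * HM => W' p.1 p.2), infinite_set (W' z'),
        forall x, W' z' x -> W z x,
        forall x, W' z' x -> forall y, f z x y -> exists v, Ys v /\ nearby c0 t v y &
        forall x, W' z' x -> forall v, Ys v -> exists y, f z x y /\ nearby c0 t v y].
Proof.
elim: n Z W f z => [|n IH] Z W f z dW df Dt iW fW.
  have [x Wx] := infinite_setN0 iW; case: (fW _ Wx).
  by exists (fun i : 'I_0 => match notF (ltn_ord i) with end); split => -[].
pose We (z : Z) x := W z x /\ ~ exists y, f z x y.
pose W1 (z : Z) x := W z x /\ exists y, f z x y.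
have dWe : dset (fun p : Z * HM => We p.1 p.2).
  by rewrite /We; ds.
have dW1 : dset (fun p : Z * HM => W1 p.1 p.2).
  by rewrite /W1; ds.
(* If no value is left at infinitely many points, the process stops with [Ys] empty. *)
have [iWe|fWe] := pselect (infinite_set (We z)).
  exists Z, We, z, (fun=> False); split => //; first by move=> x [].
  by move=> x [_ ne] y fy; case: ne; exists y.
have iW1 : infinite_set (W1 z).
  move=> fW1; apply: iW; apply: (@sub_finite_set _ _ (We z `|` W1 z)).
    by move=> x Wx; have [?|?] := pselect (exists y, f z x y); [right|left].
  by rewrite finite_setU; split => //; exact: contrapT.
have [|v hv] := near_value dW1 df Dt iW1.
  by move=> x [Wx ?]; split => //; apply/finite_notmany; exists n.+1; exact: fW.
pose W2 (w : Z * C * T * pow M l) x := W1 w.1.1.1 x /\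
  exists y, f w.1.1.1 x y /\ nearby w.1.1.2 w.1.2 w.2 y.
pose f2 (w : Z * C * T * pow M l) x y := f w.1.1.1 x y /\ ~ nearby w.1.1.2 w.1.2 w.2 y.
have dW2 : dset (fun p : (Z * C * T * pow M l) * HM => W2 p.1 p.2).
  by rewrite /W2; ds; first [by refine (dset2 dW1 _ _); dm|by refine (dset3 df _ _ _); dm
    |by refine (dset_near _ _ _ _); dm].
have df2 : dset (fun p : (Z * C * T * pow M l) * HM * pow M l => f2 p.1.1 p.1.2 p.2).
  by rewrite /f2; ds; first [by refine (dset3 df _ _ _); dm|by refine (dset_near _ _ _ _); dm].
have [||Z' [W' [z' [Ys [dW' iW' sW' h1 h2]]]]] := IH _ W2 f2 (z, c0, t, v) dW2 df2 Dt.
- exact: hv.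
- move=> x [[Wx _] [y [fy ny]]] m; apply: (fW _ Wx).
  by apply: many_add1 fy _ _ m => [[]|y' []].
exists Z', W', z', (fun w => Ys w \/ w = v); split => //.
- by move=> x /sW'[[]].
- move=> x Wx y fy; have [ny|nny] := pselect (nearby c0 t v y); first by exists v; split; [right|].
  by have [|w [Yw nw]] := h1 _ Wx y; [|exists w; split; [left|]].
- move=> x Wx w [Yw|->]; last by have [_ []] := sW' _ Wx => y; exists y.
  by have [y [[fy _] ny]] := h2 _ Wx _ Yw; exists y.
Qed.

(** The infinite set found above contains a ball, on which all values of [f] are close, up to half
    of [t], to the same [Ys]. *)
Lemma constant_interval l n (Z : dty M) (W : Z -> HM -> Prop)
    (f : Z -> HM -> pow M l -> Prop) z t :
  dset (fun p : Z * HM => W p.1 p.2) ->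
  dset (fun p : Z * HM * pow M l => f p.1.1 p.1.2 p.2) ->
  D c0 t -> infinite_set (W z) -> (forall x, W z x -> ~ many n (f z x)) ->
  exists x s, D c0 s /\ forall x', u c0 s x x' -> W z x' /\
    forall x'', u c0 s x x'' -> csets c0 t (f z x') (f z x'').
Proof.
move=> dW df /near_half[t' [Dt' ht']] iW fW.
have [Z' [W' [z' [Ys [dW' iW' sW' h1 h2]]]]] := constant_infinite dW df Dt' iW fW.
have [x [s [Ds hs]]] := @uc_interior _ _ X _ _ dW' z' iW'.
exists x, s; split => // x' /hs W'x'; split; first exact: sW'.
move=> x'' /hs W'x''; split => y fy.
- have [v [Yv nv]] := h1 _ W'x' _ fy; have [y' [fy' nv']] := h2 _ W'x'' _ Yv.
  by exists y'; split => //; apply: ht' nv'; exact: near_sym.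
- have [v [Yv nv]] := h1 _ W'x'' _ fy; have [y' [fy' nv']] := h2 _ W'x' _ Yv.
  by exists y'; split => //; apply: ht' nv; exact: near_sym.
Qed.

End generic_continuity.

(** * Boxes on which a correspondence is nearly constant *)

Section constant_boxes.
Context {L : language} {M : structure L} (M_saturated : saturated M) (X : unif_fam M).

Local Notation HM := (home_set M).
Local Notation C := (uC X).
Local Notation T := (uT X).
Local Notation c0 := (uc X).
Local Notation D := (@uD _ _ X).
Local Notation u := (@ur _ _ X).
Local Notation int := (sint D u).
Local Notation hasint := (hasint X).

Lemma constant_box l N n (Z : dty M) (f : Z -> pow M n -> pow M l -> Prop) z t x s :
  dset (fun p : Z * pow M n * pow M l => f p.1.1 p.1.2 p.2) ->
  D c0 t -> D c0 s ->
  (forall x', nearby c0 s x x' -> ~ many N (f z x')) ->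
  exists x1 s1, D c0 s1 /\ forall x', nearby c0 s1 x1 x' -> nearby c0 s x x' /\
    forall x'', nearby c0 s1 x1 x'' -> csets c0 t (f z x') (f z x'').
Proof.
elim: n Z f z t x s => [|n IH] Z f z t x s df Dt Ds fN.
  exists x, s; split => // x' xx'; split => // x'' _.
  have -> : x' = x'' by apply/pow_ext => -[].
  exact: csets_refl.
have [t' [Dt' ht']] := csets_third Dt.
pose W := (Z * pow M n.+1 * T * C * T)%type.
(* With the box and [t'] packed into [w]: the radius [s'] is good for moving coordinate 0 of [x'].
   [Bd] below collects the points of the box without a good radius. *)
pose R (w : W) (s' : T) (x' : pow M n.+1) :=
  nearby w.1.2 w.1.1.2 w.1.1.1.2 x' /\ forall y, u w.1.2 s' (x' ord0) y ->
    nearby w.1.2 w.1.1.2 w.1.1.1.2 (upd x' ord0 y) /\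
    csets w.1.2 w.2 (f w.1.1.1.1 x') (f w.1.1.1.1 (upd x' ord0 y)).
have dR : dset (fun p : W * T * pow M n.+1 => R p.1.1 p.1.2 p.2).
  rewrite /R; ds; first [by refine (dset_near _ _ _ _); dm|idtac].
  by refine (dset_csets _ _ _ _); [dm|dm|refine (dset3 df _ _ _)|refine (dset3 df _ _ _)]; dm.
pose w : W := (z, x, s, c0, t').
pose Bd (w : W) x' := nearby w.1.2 w.1.1.2 w.1.1.1.2 x' /\
  ~ exists s', D w.1.2 s' /\ R w s' x'.
have dBd : dset (fun p : W * pow M n.+1 => Bd p.1 p.2).
  rewrite /Bd; ds; first [by refine (dset_near _ _ _ _); dm|by refine (dset3 dR _ _ _); dm].
pose RE (w : W) x' := exists s', D w.1.2 s' /\ R w s' x'.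
have dRE : dset (fun p : W * pow M n.+1 => RE p.1 p.2).
  by rewrite /RE; ds; refine (dset3 dR _ _ _); dm.
have [r0 [rr [rs [rm rh]]]] := uc_unif X.
have [[b [r [Dr hr]]]|] : hasint (Bd w) \/ hasint (RE w).
- apply: (hasintU M_saturated dBd dRE); exists x, s; split => // x' xx'.
  by have [?|?] := pselect (RE w x'); [right|left].
(* Interior in [Bd] would contain an infinite part of a line in direction 0, on which
   [constant_interval] finds a point with a good radius. *)
- pose W0 (v : W * pow M n.+1) y := Bd v.1 (upd v.2 ord0 y).
  have dW0 : dset (fun p : (W * pow M n.+1) * HM => W0 p.1 p.2).
    by rewrite /W0; refine (dset2 dBd _ _); dm.
  pose f0 (v : W * pow M n.+1) y := f v.1.1.1.1.1 (upd v.2 ord0 y).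
  have df0 : dset (fun p : (W * pow M n.+1) * HM * pow M l => f0 p.1.1 p.1.2 p.2).
    by rewrite /f0; refine (dset3 df _ _ _); dm.
  have iW0 : infinite_set (W0 (w, b)).
    apply: (@sub_infinite_set _ (u c0 r (b ord0))); last exact: uc_infinite.
    move=> y by_; apply: hr => i; rewrite /upd; case: eqP => [->//|_].
    exact: rr.
  have [|y [s' [Ds' hs']]] := @constant_interval _ _ X _ N _ _ _ _ _ dW0 df0 Dt' iW0.
    by move=> y [/= ny _]; exact: fN.
  have [[ny nR] _] := hs' y (rr _ _ Ds').
  case: nR; exists s'; split => //; split => // y'.
  rewrite upd_same upd_upd => yy'; have [[ny' _] _] := hs' _ yy'; split => //.
  by have [_] := hs' y (rr _ _ Ds'); apply.
move=> hRE.
(* [RE] is a directed union over radii, so a single [s'] is good on a whole box. *)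
pose I (v : W * T) := v.1 = w /\ D c0 v.2.
have [[_ s'] [[/= -> Ds'] [b [r [Dr hr]]]]] :
    exists v : W * T, I v /\ hasint (R v.1 v.2).
  apply: (@hasint_directed _ _ M_saturated X _ (dty_prod _ _) (fun v => R v.1 v.2) I).
  - by refine (dset3 dR _ _ _); dm.
  - move=> [_ s1] [_ s2] [/= -> Ds1] [/= -> Ds2].
    have [s3 [Ds3 hs3]] := rm _ _ Ds1 Ds2.
    exists (w, s3); split => // x' [[nx' h]|[nx' h]]; split => // y /hs3[y1 y2].
      exact: h.
    exact: h.
  - have [b [r [Dr hr]]] := hRE; exists b, r; split => // x' /hr[s' [Ds' Rx']].
    by exists (w, s').
have [r2 [Dr2 hr2]] := rm _ _ Dr Ds'.
have slide x' : nearby c0 r2 b x' ->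
    csets c0 t' (f z (fcons (b ord0) (tail x'))) (f z x').
  move=> bx'; have nb : nearby c0 r b (upd x' ord0 (b ord0)).
    move=> i; rewrite /upd; case: eqP => [->|_]; first exact: rr.
    by have [] := hr2 _ _ (bx' i).
  have [_ /(_ (x' ord0))] := hr _ nb; rewrite upd_same upd_upd upd_id fcons_tail.
  by have [_ bx0] := hr2 _ _ (bx' ord0); move=> /(_ bx0)[].
(* The slice at [b ord0] has one variable less. Two points are compared by sliding to the slice,
   moving inside it and sliding back, which is why [t'] is a third of [t]. *)
pose g (v : Z * HM) x' := f v.1 (fcons v.2 x').
have dg : dset (fun p : (Z * HM) * pow M n * pow M l => g p.1.1 p.1.2 p.2).
  by rewrite /g; refine (dset3 df _ _ _); dm.
have [|b' [s1' [Ds1' hs1']]] := IH _ g (z, b ord0) t' (tail b) r2 dg Dt' Dr2.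
  move=> x' bx'; apply: fN; have [] := hr (fcons (b ord0) x') => // i.
  case: (unliftP ord0 i) => [j|] ->; rewrite ?fconsS ?fcons0; last exact: rr.
  by have [] := hr2 _ _ (bx' j).
have [s1 [Ds1 hs1]] := rm _ _ Ds1' Dr2.
exists (fcons (b ord0) b'), s1; split => //.
have in_box x' : nearby c0 s1 (fcons (b ord0) b') x' ->
    nearby c0 s1' b' (tail x') /\ nearby c0 r2 b x'.
  move=> nx'.
  have nt : nearby c0 s1' b' (tail x').
    by move=> i; have := nx' (lift ord0 i); rewrite fconsS => /hs1[].
  split => // i; case: (unliftP ord0 i) => [j|] ->.
    by have [h _] := hs1' _ nt; exact: h.
  by have := nx' ord0; rewrite fcons0 => /hs1[].
move=> x' /in_box[nt' nx']; split.
  have [|h _] := hr x'; last exact: h.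
  by move=> i; have [] := hr2 _ _ (nx' i).
move=> x'' /in_box[nt'' nx''].
have h3 : csets c0 t' (f z (fcons (b ord0) (tail x'))) (f z (fcons (b ord0) (tail x''))).
  by have [_] := hs1' _ nt'; apply.
by apply: ht' h3 (slide _ nx''); apply: csets_sym => //; exact: slide.
Qed.

Definition continuous_in n l (Z : dty M) (V : Z -> pow M n -> Prop)
    (f : Z -> pow M n -> pow M l -> Prop) c z x :=
  forall t, D c t -> exists s, D c s /\
    forall x', V z x' -> nearby c s x x' -> csets c t (f z x) (f z x').

Lemma dset_continuous_in n l (Z : dty M) (V : Z -> pow M n -> Prop)
    (f : Z -> pow M n -> pow M l -> Prop) :
  dset (fun p : Z * pow M n => V p.1 p.2) ->
  dset (fun p : Z * pow M n * pow M l => f p.1.1 p.1.2 p.2) ->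
  dset (fun p : C * Z * pow M n => continuous_in V f p.1.1 p.1.2 p.2).
Proof.
move=> dV df; rewrite /continuous_in; ds;
  first [by refine (dset2 dV _ _); dm|by refine (dset_near _ _ _ _); dm|idtac].
by refine (dset_csets _ _ _ _); [dm|dm|refine (dset3 df _ _ _)|refine (dset3 df _ _ _)]; dm.
Qed.

(** For fixed [t], a box of points without a suitable radius would contain a smaller box on which
    [f] is constant up to [t], which is absurd. Shrinking [t] enlarges the set of such points, so
    the union over [t] is directed. *)
Lemma discontinuity_thin n l (Z : dty M) (V : Z -> pow M n -> Prop)
    (f : Z -> pow M n -> pow M l -> Prop) z N :
  dset (fun p : Z * pow M n => V p.1 p.2) ->
  dset (fun p : Z * pow M n * pow M l => f p.1.1 p.1.2 p.2) ->
  (forall x, V z x -> ~ many N (f z x)) ->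
  ~ hasint (fun x => V z x /\ ~ continuous_in V f c0 z x).
Proof.
move=> dV df fN hD.
pose W := (C * Z * T)%type.
pose A (w : W) x := V w.1.2 x /\ ~ exists s, D w.1.1 s /\
  forall x', V w.1.2 x' -> nearby w.1.1 s x x' -> csets w.1.1 w.2 (f w.1.2 x) (f w.1.2 x').
have dA : dset (fun p : W * pow M n => A p.1 p.2).
  rewrite /A; ds;
    first [by refine (dset2 dV _ _); dm|by refine (dset_near _ _ _ _); dm|idtac].
  by refine (dset_csets _ _ _ _); [dm|dm|refine (dset3 df _ _ _)|refine (dset3 df _ _ _)]; dm.
pose I (w : W) := w.1 = (c0, z) /\ D c0 w.2.
have [r0 [rr [rs [rm rh]]]] := uc_unif X.
have [[_ t] [[/= -> Dt] [x [s [Ds hs]]]]] :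
    exists w : W, I w /\ hasint (A w).
  apply: (@hasint_directed _ _ M_saturated X _ _ A I dA).
  - move=> [_ t1] [_ t2] [/= -> Dt1] [/= -> Dt2].
    have [t3 [Dt3 ht3]] := rm _ _ Dt1 Dt2.
    have csets_le t : (forall y y', u c0 t3 y y' -> u c0 t y y') ->
        forall S S' : pow M l -> Prop, csets c0 t3 S S' -> csets c0 t S S'.
      move=> le S S' [h h']; split => y.
      + by move=> /h[y' [? ny]]; exists y'; split => // i; exact: le.
      + by move=> /h'[y' [? ny]]; exists y'; split => // i; exact: le.
    exists ((c0, z), t3); split => // x' [[Vx' h]|[Vx' h]]; split => //;
      apply: contra_not h => -[s [Ds hs]]; exists s; split => // x'' Vx'' nx'';
      apply: csets_le (hs _ Vx'' nx'') => y y' /ht3[] //.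
  - have [x [s [Ds hs]]] := hD; exists x, s; split => // x' /hs[Vx'].
    move=> /existsNP[t /not_implyP[Dt ns]].
    by exists ((c0, z), t); split.
have [|x1 [s1 [Ds1 hs1]]] := @constant_box l N n Z f z t x s df Dt Ds.
  by move=> x' /hs[Vx' _]; exact: fN.
have [nx1 cx1] := hs1 _ (near_refl _ Ds1).
have [_ nA] := hs _ nx1; apply: nA; exists s1; split => // x' _.
exact: cx1.
Qed.

End constant_boxes.

(** * Dimension *)

Section dimension.
Context {L : language} {M : structure L} (M_saturated : saturated M) (X : unif_fam M).

Local Notation HM := (home_set M).
Local Notation hasint := (hasint X).

Lemma bigminn_le (I : Type) (r : seq I) (P : pred I) (F : I -> nat) x n :
  \big[minn/x]_(i <- r | P i) F i <= n ->
  x <= n \/ exists i, P i /\ F i <= n.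
Proof.
elim: r => [|j r IH]; first by rewrite big_nil; left.
rewrite big_cons; case: ifP => [Pj|_]; last exact: IH.
rewrite geq_min => /orP[h|/IH//]; by right; exists j.
Qed.

Lemma bigminn_inf (I : eqType) (r : seq I) (P : pred I) (F : I -> nat) x i :
  i \in r -> P i -> \big[minn/x]_(i <- r | P i) F i <= F i.
Proof.
elim: r => //= j r IH; rewrite inE big_cons => /predU1P[<-|ir] Pi.
  by rewrite Pi geq_minl.
by case: ifP => _; rewrite ?geq_min IH ?orbT.
Qed.

Lemma acl_intro (C : set (elt M)) (a : HM) (A : HM -> Prop) :
  dset_over C (A : dty_el M (home L) -> Prop) -> A a -> finite_set A ->
  acl C (home_elt a).
Proof.
move=> [Zc [c [A' [dA' cC hA]]]] Aa fA.
have /definable_overP[p hp] : dset_over C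
    ((fun v => A (v ord0)) : dty_asg M (fun _ : 'I_1 => home L) -> Prop).
  exists Zc, c, (fun q => A' (q.1, q.2 ord0)); split => //.
    by refine (dset_comp dA' (f := fun q : Zc * asg M (fun _ : 'I_1 => home L) =>
      (q.1, q.2 ord0)) _); dm.
exists p; split; first by have : [set v | psat p v] (fun=> a) by rewrite -hp.
rewrite -hp; apply: (@sub_finite_set _ _ ((fun y _ => y) @` (A : set HM))).
  move=> v Av; exists (v ord0) => //.
  by apply/functional_extensionality_dep => i; rewrite (ord1 i).
exact: finite_image.
Qed.

Lemma acl_mem (C : set (elt M)) (a : HM) : C (home_elt a) -> acl C (home_elt a).
Proof.
move=> Ca; apply: (@acl_intro C a (fun y => y = a)) => //; last exact: finite_set1.
exists (dty_el M (home L)), a, (fun q => q.2 = q.1); split => //.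
by apply: dset_eqZ; dm.
Qed.

(** If [a] lies in the [i]-th thin set, its coordinate [i] has finitely many possible values over
    [C] and the other coordinates, so these span. It matters that the thin sets are definable from
    [c] alone: [C] need not define the topology. *)
Lemma dim_tuple_thin (C : set (elt M)) n (A : set (pow M n)) a :
  definable_over C A -> ~ hasint A -> A a -> (dim_tuple C a < n)%N.
Proof.
move=> /definable_overP[Zc [c [A' [dA' cC hA]]]] nA Aa.
have dA2 : dset (fun p : Zc * pow M n => A' (p.1, p.2)).
  by apply: dset_ext dA' => -[].
have [E [N [dE thin cov]]] := @thin_cover _ _ M_saturated X n Zc (fun c x => A' (c, x)) dA2.
have [|i Ei] := cov c _ a ((hA a).1 Aa).
  by apply: contra_not nA; apply: hasintS => x /hA.
apply: (@leq_ltn_trans #|[set~ i]%SET|); last first.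
  by rewrite cardsC1 card_ord; case: (n) (i) => [[]|].
rewrite /dim_tuple; apply: bigminn_inf; first exact: mem_index_enum.
apply/asboolP => j; have [->|ji] := eqVneq j i; last first.
  by apply: acl_mem; right; exists j => //=; rewrite !inE.
apply: (@acl_intro _ (a i) (fun y => E i c (upd a i y))); last first.
- by apply/finite_notmany; exists N; exact: thin.
- by rewrite upd_id.
pose J := {j : 'I_n | j != i}.
pose H (j : J) := home L.
pose fill (q : asg M H) (y : HM) : pow M n :=
  fun j => if insub j is Some k then q k else y.
exists (dty_prod Zc (dty_asg M H)), (c, fun k => a (val k)),
  (fun q => E i q.1.1 (fill q.1.2 q.2)); split.
- refine (dset2 (dE i) _ _); first by dm.
  apply: dmap_asg => j' /=; rewrite /fill.
  case: (insub j') => [k|]; last by dm.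
  exact: (@dmap_proj _ _ _ _ _ (fun q : Zc * asg M H * HM => q.1.2) k
      (dmap_snd (dmap_fst (@dmap_id _ _ _)))).
- move=> [k|k] /=; first by left; exact: cC.
  by right; exists (val k) => //=; rewrite !inE; exact: (valP k).
- move=> y /=; suff -> : fill (fun k => a (val k)) y = upd a i y by [].
  apply/pow_ext => j'; rewrite /fill /upd; case: insubP => [k kj ->|].
    by rewrite (negbTE kj).
  by rewrite negbK => ->.
Qed.

Lemma many_bigcup (U : Type) k (N : 'I_k -> nat) (S : 'I_k -> set U) :
  many (\sum_i N i).+1 (fun x => exists i, S i x) -> exists i, many (N i) (S i).
Proof.
elim: k N S => [|k IH] N S.
  by rewrite big_ord0 => -[g [_ /(_ ord0)[[]]]].
rewrite big_ord_recl -addnS => h.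
have [m0|m1] : many (N ord0) (S ord0) \/ many (\sum_(i < k) N (lift ord0 i)).+1
    (fun x => exists i, S (lift ord0 i) x).
- apply: manyU; apply: many_sub h => x [i Si].
  by case: (unliftP ord0 i) Si => [j|] -> Sx; [right; exists j|left].
- by exists ord0.
- by have [i ?] := IH _ _ m1; exists (lift ord0 i).
Qed.

(* Passing all these tests means that no coordinate is algebraic over [C] and the
   other coordinates. *)
Record acl_test (C : set (elt M)) n := AclTest {
  at_i : 'I_n;
  at_Q : set (pow M n);
  at_N : nat;
  at_def : definable_over C at_Q }.

Definition at_pass (C : set (elt M)) n (t : acl_test C n) (x : pow M n) :=
  ~ (at_Q t x /\ ~ many (at_N t) (fun y => at_Q t (upd x (at_i t) y))).

(** By saturation, finitely many tests suffice. Each is failed on a set thin in one direction, and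
    finitely many such sets cannot cover a large grid in [A]. *)
Lemma generic_point (C : set (elt M)) n (A : set (pow M n)) :
  small C -> definable_over C A -> hasint A ->
  exists2 a, A a & forall t : acl_test C n, at_pass t a.
Proof.
move=> sC dA iA.
pose P (o : option (acl_test C n)) x := if o is Some t then at_pass t x else A x.
have [||x hx] := @saturated_dset _ _ M_saturated C (dty_asg M (@homes L 'I_n)) _ P sC.
- move=> [t|]; last exact/definable_overP.
  have /definable_overP[Zc [c [A' [dA' cC hA]]]] := at_def t.
  exists Zc, c, (fun q => ~ (A' q /\
    ~ many (at_N t) (fun y => A' (q.1, upd q.2 (at_i t) y)))); split => //.
    by ds; refine (dset_comp dA' _); dm.
  have Qe : at_Q t = (fun x => A' (c, x)) by apply/funext => x; apply/propext; exact: hA.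
  by move=> x; rewrite /= /at_pass Qe.
- move=> k g; apply: contrapT => ng.
  pose bad (s : 'I_k) i x := if g s is Some t then at_i t = i /\ ~ at_pass t x else False.
  (* The extra one guarantees a bad point on the line, and failing the test there already bounds the
     points of [at_Q] on that line. *)
  pose N (s : 'I_k) := if g s is Some t then (at_N t).+1 else 1%N.
  have [G [iG hG]] := hasint_grid (n * (\sum_s N s).+1).+1 iA.
  have : ((n * (\sum_s N s).+1).+1 <= n * (\sum_s N s).+1)%N; last by rewrite ltnn.
  apply: (@grid_thin _ _ n _ (\sum_s N s).+1 G (fun i x => exists s, bad s i x)).
    move=> i x /many_bigcup[s]; rewrite /N /bad; case: (g s) => [t|]; last first.
      by move=> [g0 [_ /(_ ord0)]].
    move=> m; have [g0 [_ /(_ ord0)[ei /contrapT[_ nm]]]] := m.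
    apply: nm; apply: many_leq (leqnSn _) _; apply: many_sub m => y [_ /contrapT[Qy _]].
    by rewrite ei upd_upd.
  split => // e; apply: contrapT => nE; apply: ng; exists (fun i => G i (e i)) => s.
  rewrite /P; case egs: (g s) => [t|]; last exact: hG.
  apply: contrapT => nt; apply: nE; exists (at_i t), s.
  by rewrite /bad egs.
- by exists x; [exact: (hx None)|move=> t; exact: (hx (Some t))].
Qed.

(** If fewer than [n] coordinates spanned, some coordinate [i] outside [J] would be algebraic over
    [C] and those in [J]. Turning the latter from parameters into variables gives a test that [a]
    fails. *)
Lemma generic_dim (C : set (elt M)) n (A : set (pow M n)) :
  small C -> definable_over C A -> hasint A -> exists2 a, A a & dim_tuple C a = n.
Proof.
move=> sC dA iA; have [a Aa ha] := generic_point sC dA iA.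
exists a => //; apply/eqP; rewrite eqn_leq; apply/andP; split.
  apply: leq_trans (@bigminn_inf _ _ _ _ n [set: 'I_n]%SET (mem_index_enum _) _) _.
    by apply/asboolP => i; apply: acl_mem; right; exists i => //=; rewrite inE.
  by rewrite cardsT card_ord.
rewrite leqNgt; apply/negP => lt.
have n0 : (0 < n)%N by exact: leq_trans lt.
(* The first case is the default value [n] of the minimum, which is too large. *)
have [|[J [/asboolP span leJ]]] : n <= n.-1 \/ exists J : {set 'I_n},
    `[< acl_spans C a J >] /\ #|J| <= n.-1.
- by apply: (@bigminn_le _ (index_enum _)); rewrite -ltnS prednK.
- by rewrite -ltnS prednK // ltnn.
have [i iJ] : exists i, i \notin J.
  apply: contrapT => nJ; suff JT : J = [set: 'I_n]%SET.
    by move: leJ; rewrite JT cardsT card_ord -ltnS prednK // ltnn.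
  apply/setP => i; rewrite !inE; apply: contrapT => /negP iJ.
  by apply: nJ; exists i.
have [p [pa finp]] := span i.
have /definable_overP[Zc [c [A' [[p' hp'] cC hA]]]] :
  definable_over (C `|` [set home_elt (a j) | j in [set` J]]) [set v | psat p v] by exists p.
(* [K] collects the parameters lying in [C]; a parameter outside [C] is some [a j] with [j] in [J]
   and is replaced by a variable. *)
pose K := {d : dix Zc | `[< C (existT _ (dsrt d) (enc c d)) >]}.
pose c2 (k : K) := enc c (val k).
pose S := sum_sort (fun k : K => dsrt (val k)) (@homes L 'I_n).
have terms (x : elt M) : (exists k : K, x = existT _ (dsrt (val k)) (enc c (val k))) \/
    (exists2 j, j \in J & x = home_elt (a j)) ->
    exists t : term S (projT1 x), forall x' : pow M n, (forall j, j \in J -> x' j = a j) ->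
      teval (vcat c2 x') t = projT2 x.
  move=> [[k ->]|[j jJ ->]].
  - by exists (@TVar L _ S (inl k)).
  - by exists (@TVar L _ S (inr j)) => x' /(_ j jJ).
have termd d : exists t : term S (dsrt d),
    forall x' : pow M n, (forall j, j \in J -> x' j = a j) ->
      teval (vcat c2 x') t = enc c d.
  apply: (terms (existT _ (dsrt d) (enc c d))).
  case: (cC d) => [Cd|[j /= jJ ej]]; last by right; exists j.
  by left; exists (exist (fun d => `[< C (existT _ (dsrt d) (enc c d)) >]) d (asboolT Cd)).
pose t d := sval (cid (termd d)).
have ht d : forall x' : pow M n, (forall j, j \in J -> x' j = a j) ->
  teval (vcat c2 x') (t d) = enc c d := svalP (cid (termd d)).
pose r (x : dix Zc + 'I_1) : term S (sum_sort (@dsrt _ _ Zc) (fun _ : 'I_1 => home L) x) :=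
  match x return term S (sum_sort (@dsrt _ _ Zc) (fun _ : 'I_1 => home L) x) with
  | inl d => t d
  | inr _ => @TVar L _ S (inr i)
  end.
pose Q : set (pow M n) := [set x | sat (fsubst p' r) (vcat c2 x)].
have QE (x' : pow M n) : (forall j, j \in J -> x' j = a j) ->
    Q x' <-> psat p (fun=> x' i).
  move=> hx'; rewrite /Q /= sat_subst.
  have -> : psat p (fun=> x' i) <-> A' (c, fun=> x' i) by exact: (hA (fun=> x' i)).
  rewrite hp'.
  suff -> : (fun d => teval (vcat c2 x') (r d)) =
      enc ((c, fun=> x' i) : dty_prod Zc (dty_asg M (fun _ : 'I_1 => home L))) by [].
  by apply/functional_extensionality_dep => -[d|k] //=; exact: ht.
have dQ : definable_over C Q.
  apply/definable_overP.
  exists (dty_asg M (fun k : K => dsrt (val k))), c2,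
    (fun q => sat (fsubst p' r) (vcat q.1 q.2)); split => //.
    by exists (fsubst p' r).
  by move=> k; have /asboolP := valP k.
have [N hN] : exists N, ~ many N (fun y => psat p (fun=> y)).
  apply/finite_notmany; apply: sub_finite_set (finite_image (fun v => v ord0) finp).
  by move=> y py; exists (fun=> y).
have upd_agree y : forall j, j \in J -> upd a i y j = a j.
  by move=> j jJ; rewrite /upd; case: eqP => // ji; rewrite -ji jJ in iJ.
apply: (ha (AclTest i N dQ)); split.
  by apply/QE.
apply: contra_not hN; apply: many_sub => y /= /(QE _ (upd_agree y)).
by rewrite upd_same.
Qed.

End dimension.

(** * The product topology *)

Section topology.
Context {T : Type} {B : set (set (T * T))} (hB : uniform_structure B).

Lemma unif_refl U (x : T) : B U -> U (x, x).
Proof.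
move=> BU; have : (\bigcap_(U in B) U) (x, x) by rewrite (unif_diag hB).
by apply.
Qed.

Lemma unif_symm U (x y : T) : B U -> U (x, y) -> U (y, x).
Proof. by move=> BU; rewrite -{2}(unif_sym hB BU). Qed.

Lemma unif_half U : B U -> exists2 V, B V & forall x y z, V (x, y) -> V (y, z) -> U (x, z).
Proof.
move=> /(unif_split hB)[V BV sV]; exists V => // x y z xy yz.
by apply: sV; exists y.
Qed.

(** Balls need not be open, but by halving, the points having a ball inside [A] form an open set. *)
Lemma nbhs_utop (x : utop hB) (A : set (utop hB)) :
  nbhs x A <-> exists2 U, B U & forall y, U (x, y) -> A y.
Proof.
split.
  rewrite nbhsE => -[W [oW Wx] WA].
  have [U BU UW] := (oW : uopen W) x Wx.
  by exists U => // y xy; apply/WA/UW; rewrite /xsection /= inE.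
move=> [U BU UA].
pose O : set (utop hB) := [set y | exists2 V, B V & forall z, V (y, z) -> A z].
rewrite nbhsE; exists O; last by move=> y [V BV]; apply; exact: unif_refl.
split; last by exists U.
suff : uopen O by [].
move=> y [V BV VA]; have [W BW WV] := unif_half BV; exists W => // z.
rewrite /xsection /= inE => yz; exists W => // w zw; exact/VA/WV/zw.
Qed.

Lemma unif_separate U (x y : T) : B U -> x <> y ->
  exists2 V, B V & V `<=` U /\ ~ V (x, y).
Proof.
move=> BU xy; have : ~ (\bigcap_(U in B) U) (x, y) by rewrite (unif_diag hB).
move=> /existsNP[V /not_implyP[BV nV]].
have [W BW WUV] := unif_meet hB BU BV; exists W => //.
by split=> [p /WUV[]|/WUV[_ /nV]].
Qed.

(** If the ball were finite, a smaller entourage would separate [x] from each of its other points,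
    and [x] would be isolated. *)
Lemma unif_infinite U (x : utop hB) : ~ isolated [set: utop hB] x -> B U ->
  infinite_set [set y | U (x, y)].
Proof.
move=> nx BU /finite_enum[n [g [_ sg]]]; apply: nx; split; first by rewrite inE.
have [V BV VU] : exists2 V, B V & V `<=` U /\ forall i : 'I_n, g i <> x -> ~ V (x, g i).
  suff /(_ n (leqnn n))[V BV [VU h]] : forall m, m <= n -> exists2 V, B V &
      V `<=` U /\ forall i : 'I_n, (i < m)%N -> g i <> x -> ~ V (x, g i).
    by exists V => //; split => // i; apply: h.
  elim=> [|m IH] mn; first by exists U => //; split.
  have [V BV [VU h]] := IH (ltnW mn); pose k := Ordinal mn.
  have h' W (i : 'I_n) : W `<=` V -> (i < m)%N -> g i <> x -> ~ W (x, g i).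
    by move=> WV im gi /WV; exact: h.
  have im (i : 'I_n) : (i < m.+1)%N -> i = k \/ (i < m)%N.
    by rewrite ltnS leq_eqVlt => /predU1P[e|]; [left; exact: val_inj|right].
  have [gk|gk] := pselect (g k = x).
    by exists V => //; split => // i /im[-> //|]; exact: h'.
  have [W BW [WV nW]] := unif_separate BV (nesym gk).
  exists W => //; split; first exact: subset_trans VU.
  by move=> i /im[-> _|] //; exact: h'.
exists [set y | V (x, y)].
  by apply/nbhs_utop; exists V.
apply/seteqP; split => y /=; last by move=> ->; split => //; exact: unif_refl.
move=> [Vxy _]; have [i gi] := sg y (VU.1 _ Vxy).
by apply: contrapT => yx; apply: (VU.2 i); rewrite gi.
Qed.

End topology.

Section product_topology.
Context {L : language} {M : structure L} {B : set (set (home_set M * home_set M))}.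
Variable hB : uniform_structure B.

(** The sets containing a ball of one common radius form a filter, whose convergence to [x] is
    checked coordinatewise. Conversely, a ball is a finite intersection of preimages under the
    projections. *)
Lemma nbhs_pow k (x : pow_top hB k) (A : set (pow_top hB k)) :
  nbhs x A <-> exists2 U, B U & forall y, close_tuples U x y -> A y.
Proof.
split.
  pose F : set_system (pow_top hB k) :=
    [set A | exists2 U, B U & forall y, close_tuples U x y -> A y].
  have FF : Filter F.
    split.
    - by have [U BU] := unif_nonempty hB; exists U.
    - move=> P Q [U BU UP] [V BV VQ]; have [W BW WUV] := unif_meet hB BU BV.
      exists W => // y xy; split; [apply: UP|apply: VQ] => i.
      + by have [] := WUV _ (xy i).
      + by have [] := WUV _ (xy i).
    - by move=> P Q PQ [U BU UP]; exists U => // y /UP /PQ.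
  suff : F --> x by apply.
  apply/cvg_sup => i Q; rewrite nbhsE /= => -[_ [[W oW <-] Wx] WQ].
  have [U BU UW] := (oW : uopen W) _ Wx.
  exists U => // y xy; apply/WQ/UW; rewrite /xsection /= inE; exact: xy.
move=> [U BU UA]; apply: (filterS UA).
apply: (@filter_forall (pow_top hB k) _ (fun (i : 'I_k) y => U (x i, y i)) (nbhs x)) => i.
have Ni : nbhs (proj i x : utop hB) [set z | U (x i, z)] by apply/nbhs_utop; exists U.
exact: (@proj_continuous _ (fun _ : 'I_k => utop hB) i x _ Ni).
Qed.

Lemma open_pow k (A : set (pow_top hB k)) :
  open A <-> forall x, A x -> exists2 U, B U & forall y, close_tuples U x y -> A y.
Proof.
rewrite openE; split => [h x /h /nbhs_pow//|h x Ax].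
by apply/nbhs_pow; exact: h.
Qed.

End product_topology.

(** * The given uniform structure as a member of a family *)

Section unif_family.
Context {L : language} {M : structure L} (B : set (set (home_set M * home_set M))).
Hypothesis B_uniform : uniform_structure B.
Hypothesis B_definable : definable_family2 B.
Hypothesis M_no_isolated :
  forall x : utop B_uniform, ~ isolated [set: utop B_uniform] x.
Hypothesis M_interior : forall A : set (utop B_uniform),
  @definable1 L M A -> infinite_set A -> (interior A) !=set0.

(** [c0] collects the parameters of the index set and of the formula; letting them vary gives a
    family definable without parameters. *)
Lemma unif_fam_exists : exists X : unif_fam M,
  forall U, B U <-> exists t, uD (uc X) t /\ U = [set xy | ur (uc X) t xy.1 xy.2].
Proof.
have [n [H [D [p [dD eB]]]]] := B_definable.
have [Z1 [c1 [D' [dD' eD]]]] := definable_dset dD.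
have /definable_dset[Z2 [c2 [P [dP eP]]]] : definable [set v | psat p v] by exists p.
pose T := dty_asg M H.
pose c0 : Z1 * Z2 := (c1, c2).
pose uD (c : Z1 * Z2) (t : T) := D' c.1 t.
pose u (c : Z1 * Z2) (t : T) x y := P c.2 (vcat (vcat (pow1 x) (pow1 y)) t).
have duD : dset (fun q : (Z1 * Z2) * T => uD q.1 q.2).
  by refine (dset2 dD' _ _); dm.
have du : dset (fun q : (Z1 * Z2) * T * home_set M * home_set M =>
    u q.1.1.1 q.1.1.2 q.1.2 q.2).
  refine (dset2 dP _ _); first by dm.
  apply: dmap_asg => -[[i|i]|i] /=; [by rewrite /pow1; dm|by rewrite /pow1; dm|].
  exact: (@dmap_proj _ _ _ _ _ (fun q : (Z1 * Z2) * T * home_set M * home_set M => q.1.1.2) i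
      (dmap_snd (dmap_fst (dmap_fst (@dmap_id _ _ _))))).
have BE U : B U <-> exists t, uD c0 t /\ U = [set xy | u c0 t xy.1 xy.2].
  have e t : [set xy | psat p (vcat (vcat (pow1 xy.1) (pow1 xy.2)) t)] =
      [set xy | u c0 t xy.1 xy.2].
    apply/funext => xy.
    exact: (congr1 (fun Q : set _ => Q (vcat (vcat (pow1 xy.1) (pow1 xy.2)) t)) eP).
  rewrite eB; split => [[t Dt <-]|[t [Dt ->]]].
    by exists t; split; rewrite ?e // /uD -eD.
  by exists t; rewrite ?e // eD.
have uB t : uD c0 t -> B [set xy | u c0 t xy.1 xy.2] by move=> Dt; apply/BE; exists t.
have unif0 : is_unif uD u c0.
  split; last split; last split; last split.
  - by have [U /BE[t [Dt _]]] := unif_nonempty B_uniform; exists t.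
  - by move=> t y Dt; exact: (unif_refl B_uniform y (uB t Dt)).
  - by move=> t y y' Dt; exact: (unif_symm B_uniform (uB t Dt)).
  - move=> t t' Dt Dt'.
    have [W /BE[t'' [Dt'' ->]] sW] := unif_meet B_uniform (uB _ Dt) (uB _ Dt').
    by exists t''; split => // y y' h; exact: (sW (y, y') h).
  - move=> t Dt; have [W /BE[t' [Dt' ->]] sW] := unif_half B_uniform (uB _ Dt).
    by exists t'; split => // y y' y''; exact: sW.
have inf0 t y : uD c0 t -> infinite_set (u c0 t y).
  move=> Dt fin; have := unif_infinite (@M_no_isolated y) (uB _ Dt).
  by apply; exact: fin.
have int0 (Z : dty M) (R : Z -> home_set M -> Prop) :
    dset (fun q : Z * home_set M => R q.1 q.2) ->
    forall z, infinite_set (R z) -> exists y, sint uD u c0 (R z) y.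
  move=> dR z iR.
  have dRz : @definable1 L M (R z).
    apply: (@dset_definable _ _ _ _ Z z (fun z v => R z (v ord0))).
    by refine (dset2 dR _ _); dm.
  have [y] := M_interior dRz iR.
  move=> /nbhs_utop[U /BE[t [Dt ->]] h].
  by exists y, t.
by exists (UnifFam duD du unif0 inf0 int0).
Qed.

End unif_family.

(** * The theorem *)

Section dimension_of_sets.
Context {L : language} {M : structure L} (M_saturated : saturated M) (X : unif_fam M).

Lemma acl_dim_over k (A : set (pow M k)) : definable A ->
  exists C, [/\ small C, definable_over C A & acl_dim A = dim_over C A].
Proof.
move=> /definable_small h; exists (xget set0 [set C | small C /\ definable_over C A]).
by have [] : [set C | small C /\ definable_over C A]
  (xget set0 [set C | small C /\ definable_over C A]) by exact: xgetPex.
Qed.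

Lemma acl_dim_hasint k (A : set (pow M k)) : definable A -> hasint X A ->
  acl_dim A = (Posz k)%:E.
Proof.
move=> dA iA; have [C [sC CA ->]] := acl_dim_over dA.
have [a Aa da] := generic_dim M_saturated sC CA iA.
rewrite /dim_over asboolF; last by move=> A0; rewrite A0 in Aa.
congr (Posz _)%:E; apply/eqP; rewrite eqn_leq; apply/andP; split.
  by apply/bigmax_leqP => l _; rewrite -ltnS.
apply: (leq_bigmax_cond (F := fun l : 'I_k.+1 => l : nat) (ord_max : 'I_k.+1)).
by apply/asboolP; exists a.
Qed.

Lemma acl_dim_thin k (A : set (pow M k)) : definable A -> ~ hasint X A ->
  (acl_dim A < (Posz k)%:E)%E.
Proof.
move=> dA nA; have [C [sC CA ->]] := acl_dim_over dA.
rewrite /dim_over; case: asboolP => [_|/eqP/set0P[a Aa]]; first exact: ltNyr.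
have lt b : A b -> (dim_tuple C b < k)%N by move=> Ab; exact: dim_tuple_thin CA nA Ab.
rewrite lte_fin ltz_nat.
have k0 : (0 < k)%N by exact: leq_ltn_trans (lt a Aa).
apply: (@leq_ltn_trans k.-1); last by rewrite ltn_predL.
apply/bigmax_leqP => l /asboolP[b Ab <-].
by rewrite -ltnS prednK //; exact: lt.
Qed.

End dimension_of_sets.

Theorem proposition3p7 (L : language) (T : theory L)
    (T_complete : complete_theory T) (T_NIP : NIP T)
    (M : structure L) (M_model : model T M) (M_saturated : saturated M)
    (M_dp_minimal : dp_minimal M)
    (B : set (set (home_set M * home_set M)))
    (B_uniform : uniform_structure B) (B_definable : definable_family2 B)
    (M_no_isolated : forall x : utop B_uniform, ~ isolated [set: utop B_uniform] x)
    (M_interior : forall A : set (utop B_uniform),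
       @definable1 L M A -> infinite_set A -> (interior A) !=set0)
    (k l : nat) (V : set (pow M k))
    (V_definable : definable V)
    (V_open : open (V : set (pow_top B_uniform k)))
    (f : set (pow M k * pow M l))
    (f_corr : correspondence V [set: pow M l] f) :
  (exists O : set (pow_top B_uniform k),
     [/\ open O, O `<=` V, V `<=` closure O &
         forall x, O x -> corr_continuous_at B V f x]) /\
  holds_ae V (corr_continuous_at B V f).
Proof.
have [X BX] := unif_fam_exists B_definable M_no_isolated M_interior.
have [_ _ _ f_definable f_finite] := f_corr.
have [Z1 [z1 [V1 [dV1 eV]]]] := definable_dset V_definable.
have [Z2 [z2 [P [dP eP]]]] := definable_dset f_definable.
pose Z := dty_prod Z1 Z2; pose z : Z := (z1, z2).
pose V2 (w : Z) := V1 w.1.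
pose f2 (w : Z) (x : pow M k) (y : pow M l) := P w.2 (vcat x y).
have dV2 : dset (fun p : Z * pow M k => V2 p.1 p.2) by refine (dset2 dV1 _ _); dm.
have df2 : dset (fun p : Z * pow M k * pow M l => f2 p.1.1 p.1.2 p.2).
  refine (dset2 dP _ _); first by dm.
  by apply: dmap_asg => -[i|i] /=; dm.
have fE x : xsection f x = f2 z x.
  apply/funext => y; apply/propext; rewrite /f2 /= -eP /xsection /= inE.
  split; first by exists (x, y).
  move=> [[x' y'] fxy] e.
  have -> : x = x' by apply/pow_ext => i; exact: (congr1 (fun v => v (inl i)) (esym e)).
  by have -> : y = y' by apply/pow_ext => i; exact: (congr1 (fun v => v (inr i)) (esym e)).
(* Saturation turns finiteness of each [f x] into one bound for all [x] in [V]. *)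
have [N fN] : exists N, forall x, V2 z x -> ~ many N (f2 z x).
  apply: contrapT => nN.
  have [||n|x hx] := @saturated_seq _ _ M_saturated Z _ z
    (fun n w x => V2 w x /\ many n (f2 w x)).
  - by move=> n; ds.
  - by move=> n x [Vx m]; split => //; exact: many_leq m.
  - apply: contrapT => h; apply: nN; exists n => x Vx m; apply: h; by exists x.
  - have Vx : V x by rewrite eV; exact: (hx 0%N).1.
    have [fin _] := f_finite x Vx.
    move: fin; rewrite fE; apply: many_infinite => n; exact: (hx n).2.
have csE t (S S' : set (pow M l)) :
    close_sets [set xy | ur (uc X) t xy.1 xy.2] S S' <-> csets (uc X) t S S'.
  split=> -[h h']; split => y.
  - by move=> /h[y' ? ?]; exists y'.
  - by move=> /h'[y' ? ?]; exists y'.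
  - by move=> /h[y' [? ?]]; exists y'.
  - by move=> /h'[y' [? ?]]; exists y'.
have contE x : corr_continuous_at B V f x <-> continuous_in V2 f2 (uc X) z x.
  split=> h.
  - move=> t Dt; have [|U /BX[s [Ds ->]] hs] := h [set xy | ur (uc X) t xy.1 xy.2].
      by apply/BX; exists t.
    exists s; split => // x' Vx' nx'; rewrite -!fE; apply/csE/hs => //.
    by rewrite eV.
  - move=> _ /BX[t [Dt ->]]; have [s [Ds hs]] := h t Dt.
    exists [set xy | ur (uc X) s xy.1 xy.2]; first by apply/BX; exists s.
    by move=> x' Vx' nx'; rewrite !fE; apply/csE/hs => //; rewrite /V2 -eV.
pose good (w : uC X * Z) (x : pow M k) := V2 w.2 x /\ continuous_in V2 f2 w.1 w.2 x.
have dgood : dset (fun p : (uC X * Z) * pow M k => good p.1 p.2).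
  rewrite /good; apply: dset_and; first by refine (dset2 dV2 _ _); dm.
  by refine (dset3 (dset_continuous_in X dV2 df2) _ _ _); dm.
pose interior_good (w : uC X * Z) (x : pow M k) :=
  exists s, uD w.1 s /\ forall x', nearby w.1 s x x' -> good w x'.
have dint : dset (fun p : (uC X * Z) * pow M k => interior_good p.1 p.2).
  rewrite /interior_good; ds; first by refine (dset_near _ _ _ _); dm.
  by refine (dset2 dgood _ _); dm.
pose W : set (pow M k) := interior_good (uc X, z).
have boxB s : uD (uc X) s -> B [set xy | ur (uc X) s xy.1 xy.2].
  by move=> Ds; apply/BX; exists s.
have W_good x : W x -> good (uc X, z) x.
  by move=> [s [Ds hs]]; apply: hs; exact: near_refl.
have W_open : open (W : set (pow_top B_uniform k)).
  apply/open_pow => x [s [Ds hs]]; have [s' [Ds' hs']] := near_half Ds.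
  exists [set xy | ur (uc X) s' xy.1 xy.2]; first exact: boxB.
  by move=> y xy; exists s'; split => // y' yy'; apply: hs; exact: hs' xy yy'.
have W_sub : W `<=` V by move=> x /W_good[]; rewrite eV.
have W_dense x s : V x -> uD (uc X) s -> exists2 y, W y & nearby (uc X) s x y.
  move=> Vx Ds.
  have [U /BX[t [Dt ->]] hV] := (@open_pow L M B B_uniform k V).1 V_open x Vx.
  have [r [Dr hr]] := near_meet Ds Dt.
  pose inbox (w : uC X * Z * pow M k * uT X) y := nearby w.1.1.1 w.2 w.1.2 y /\ good w.1.1 y.
  have dinbox : dset (fun p : (uC X * Z * pow M k * uT X) * pow M k => inbox p.1 p.2).
    rewrite /inbox; apply: dset_and; first by refine (dset_near _ _ _ _); dm.
    by refine (dset2 dgood _ _); dm.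
  pose disc (w : uC X * Z) y := V2 w.2 y /\ ~ continuous_in V2 f2 w.1 w.2 y.
  have ddisc : dset (fun p : (uC X * Z) * pow M k => disc p.1 p.2).
    rewrite /disc; apply: dset_and; first by refine (dset2 dV2 _ _); dm.
    by apply: dset_not; refine (dset3 (dset_continuous_in X dV2 df2) _ _ _); dm.
  (* Points of continuity and of discontinuity cover a box inside [V]; the latter have no interior,
     so the former do. *)
  have [] : hasint X (inbox (uc X, z, x, r)) \/ hasint X (disc (uc X, z)).
  - apply: (hasintU M_saturated dinbox ddisc); exists x, r; split => // y xy.
    have Vy : V2 z y by rewrite /V2 /= -eV; apply: hV; have [] := hr _ _ _ xy.
    by have [?|?] := pselect (continuous_in V2 f2 (uc X) z y); [left|right].
  - move=> [b [s' [Ds' hs']]].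
    exists b; first by exists s'; split => // y by_; have [_] := hs' y by_.
    by have [xb _] := hs' b (near_refl b Ds'); have [] := hr _ _ _ xb.
  - by move=> h; case: (discontinuity_thin M_saturated dV2 df2 fN h).
split.
  exists W; split => //.
  - move=> x Vx A /nbhs_pow[U /BX[s [Ds ->]] hA].
    have [y Wy xy] := W_dense x s Vx Ds; exists y; split => //; exact: hA.
  - by move=> x /W_good[_ cx]; apply/contE.
exists W; last by move=> x /W_good[_ cx]; apply/contE.
have W_definable : definable W by exact: (dset_definable (uc X, z) dint).
split => //; have [->|/set0P[x Vx]] := eqVneq V set0; [by left|right].
have iV : hasint X V.
  have [U /BX[t [Dt ->]] hV] := (@open_pow L M B B_uniform k V).1 V_open x Vx.
  by exists x, t.
rewrite (acl_dim_hasint M_saturated V_definable iV).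
apply: (acl_dim_thin M_saturated (X := X)).
- rewrite eV; apply: (dset_definable (uc X, z) (A := fun w y => V2 w.2 y /\ ~ interior_good w y)).
  apply: dset_and; first by refine (dset2 dV2 _ _); dm.
  by apply: dset_not; refine (dset2 dint _ _); dm.
(* A box in the complement of [W] in [V] would meet [W] by density. *)
- move=> [b [s [Ds hs]]].
  have [Vb _] := hs b (near_refl b Ds).
  have [y Wy by_] := W_dense b s Vb Ds.
  by have [_] := hs y by_; apply.
Qed.
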